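(* Let $\Gamma$ be a countable group, and let $(\mu_k)_{k\in\mathbb{N}}$ be a sequence of probability measures on $\Gamma$ converging pointwise to a probability measure $\mu_\infty$ on $\Gamma$. Let $(X_k,o_k)_{k\in\mathbb{N}\cup\{\infty\}}$ be a uniformly hyperbolic family of pointed metric spaces, and let $\rho_k:\Gamma\to\mathrm{Isom}(X_k)$, $k\in\mathbb{N}$, be a sequence of isometric actions of $\Gamma$ converging to an isometric action $\rho_\infty:\Gamma\to \mathrm{Isom}(X_\infty)$. Assume that $\mu_\infty$ is non-elementary for $\rho_\infty$. For each $k\in\mathbb{N}\cup\{\infty\}$ let $Z_n^{(k)}=g_1^{(k)}\cdots g_n^{(k)}$, where $(g_i^{(k)})_{i\ge1}$ is an i.i.d. sequence with common distribution $\mu_k$, and let $\ell(\mu_k)\in[0,\infty]$ be the almost sure limit $$\ell(\mu_k)=\lim_{n\to+\infty}\frac1n\,\mathrm{dist}(o_k,\rho_k(Z_n^{(k)})o_k).$$ Then $$\liminf_{k\to\infty}\ell(\mu_k)\ \ge\ \ell(\mu_\infty).$$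
   Context: Pointwise convergence means $\mu_k(g)\to\mu_\infty(g)$ for every $g\in\Gamma$. For points $x,y,o$ in a metric space, the Gromov product is $(x,y)_o=\frac12(\mathrm{dist}(o,x)+\mathrm{dist}(o,y)-\mathrm{dist}(x,y))$. A metric space $X$ is $\delta$-hyperbolic ($\delta\ge0$) if $\min((x,y)_w,(y,z)_w)\le (x,z)_w+\delta$ for all $w,x,y,z\in X$. A family $(X_k,o_k)$ of pointed metric spaces is uniformly hyperbolic if there is a single $\delta\ge0$ such that every $X_k$ is $\delta$-hyperbolic. The actions $\rho_k$ on $(X_k,o_k)$ converge to the action $\rho_\infty$ on $(X_\infty,o_\infty)$ if for each $g\in\Gamma$, $\mathrm{dist}(o_k,\rho_k(g)o_k)\to\mathrm{dist}(o_\infty,\rho_\infty(g)o_\infty)$ as $k\to\infty$. A probability measure $\mu$ on $\Gamma$ is non-elementary for an isometric action $\rho$ on a hyperbolic space if there are two elements in the semigroup generated by the support of $\mu$ which act through $\rho$ as two independent loxodromic isometries, i.e. loxodromic isometries whose sets of fixed points at infinity (in the Gromov boundary) are disjoint. *)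

(* Defs.v *)
From HB Require Import structures.
From mathcomp Require Import all_boot all_order all_algebra finmap.
From mathcomp Require Import all_classical all_reals all_analysis.

Set Implicit Arguments.
Unset Strict Implicit.
Unset Printing Implicit Defensive.
Import Order.TTheory GRing.Theory Num.Theory.
Import numFieldNormedType.Exports.
Local Open Scope classical_set_scope.
Local Open Scope ring_scope.

(* The group G carrying the sigma-algebra of all its subsets. *)
Definition discr (G : groupType) : Type := G.

HB.instance Definition _ (G : groupType) := Choice.on (discr G).
HB.instance Definition _ (G : groupType) :=
  isPointed.Build (discr G) (1%g : G).
HB.instance Definition _ (G : groupType) :=
  @isMeasurable.Build default_measure_display (discr G)
    discrete_measurable discrete_measurable0
    discrete_measurableC discrete_measurableU.

Section Hyperbolic.
Context {R : realType} {X : metricType R}.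
Implicit Types (o w x y z : X) (u v : nat -> X).

Definition gromov_product o x y : R :=
  (mdist o x + mdist o y - mdist x y) / 2.

Definition hyperbolic (delta : R) : Prop :=
  forall w x y z,
    Num.min (gromov_product w x y) (gromov_product w y z)
      <= gromov_product w x z + delta.

(* (u_m, v_n)_o --> +oo as m, n --> oo independently. *)
Definition gromov_asymptotic o u v : Prop :=
  forall A : R, exists N : nat, forall m n : nat,
    (N <= m)%N -> (N <= n)%N -> A <= gromov_product o (u m) (v n).

Definition gromov_sequence o u : Prop := gromov_asymptotic o u u.

(* A boundary point is an equivalence class of Gromov sequences.  In a
   hyperbolic space neither the classes nor the boundary depend on o. *)
Definition boundary_class o u : set (nat -> X) :=
  [set v | gromov_sequence o v /\ gromov_asymptotic o u v].

Definition gromov_boundary o : set (set (nat -> X)) :=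
  [set boundary_class o u | u in gromov_sequence o].

Definition boundary_map (f : X -> X) (xi : set (nat -> X)) : set (nat -> X) :=
  [set f \o u | u in xi].

Definition boundary_fixed_points o (f : X -> X) : set (set (nat -> X)) :=
  [set xi | gromov_boundary o xi /\ boundary_map f xi = xi].

End Hyperbolic.

Arguments hyperbolic {R} X delta.

Definition expgz (G : groupType) (g : G) (n : int) : G :=
  match n with
  | Posz m => (g ^+ m)%g
  | Negz m => (g ^- m.+1)%g
  end.

Section Actions.
Context {R : realType} {G : groupType} {X : metricType R}.
Implicit Types (rho : G -> X -> X) (g h : G) (o : X).

(* The group law forces each rho g to be bijective, so rho is a homomorphism
   from G to Isom(X). *)
Definition isometric_action rho : Prop :=
  [/\ forall x, rho 1%g x = x,
      forall g h x, rho (g * h)%g x = rho g (rho h x)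
    & forall g x y, mdist (rho g x) (rho g y) = mdist x y].

(* g is loxodromic when the orbit maps n |-> g^n x are quasi-isometric
   embeddings of Z. *)
Definition loxodromic rho g : Prop :=
  forall x : X, exists lambda c : R,
    [/\ 1 <= lambda, 0 <= c
      & forall m n : int,
          `|m - n|%:~R / lambda - c
            <= mdist (rho (expgz g m) x) (rho (expgz g n) x)
            <= lambda * `|m - n|%:~R + c].

Definition independent_loxodromic rho o g h : Prop :=
  [/\ loxodromic rho g, loxodromic rho h
    & boundary_fixed_points o (rho g) `&` boundary_fixed_points o (rho h)
      = set0].

Definition support (mu : probability (discr G) R) : set G :=
  [set g | (0 < mu [set g])%E].

Definition generated_semigroup (S : set G) : set G :=
  smallest [set T : set G | forall g h, T g -> T h -> T (g * h)%g] S.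

Definition non_elementary (mu : probability (discr G) R) rho o : Prop :=
  exists g h, [/\ generated_semigroup (support mu) g,
                  generated_semigroup (support mu) h
                & independent_loxodromic rho o g h].

End Actions.

Section RandomWalk.
Context {R : realType} {G : groupType}.
Context {d : measure_display} {Omega : measurableType d}.
Context (P : probability Omega R).

Definition mutually_independent (xi : nat -> {RV P >-> discr G}) : Prop :=
  forall (J : {fset nat}) (A : nat -> set (discr G)),
    P (\bigcap_(i in [set` J]) (xi i @^-1` A i))
      = (\prod_(i <- J) P (xi i @^-1` A i))%E.

Definition iid (mu : probability (discr G) R)
    (xi : nat -> {RV P >-> discr G}) : Prop :=
  mutually_independent xi /\
  forall (i : nat) (A : set (discr G)), distribution P (xi i) A = mu A.

(* Z_n = g_1 ... g_n, where g_{i+1} = xi i. *)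
Definition walk (xi : nat -> {RV P >-> discr G}) (n : nat) (w : Omega) : G :=
  (\prod_(i < n) (xi i w : G))%g.

Definition ae_escape_rate {X : metricType R} (rho : G -> X -> X) (o : X)
    (xi : nat -> {RV P >-> discr G}) (l : \bar R) : Prop :=
  {ae P, forall w,
    (mdist o (rho (walk xi n w) o) / n%:R)%:E @[n --> \oo] --> l}.

End RandomWalk.

(* Main.v *)
Require Import Defs.
From mathcomp Require Import all_boot all_order all_algebra finmap.
From mathcomp Require Import all_classical all_reals all_analysis.
From mathcomp Require Import measurable_realfun ring lra zify.
Set Implicit Arguments.
Unset Strict Implicit.
Unset Printing Implicit Defensive.
Import Order.TTheory GRing.Theory Num.Theory.
Import numFieldNormedType.Exports.
Local Open Scope classical_set_scope.
Local Open Scope ring_scope.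

(** Write [len g] for the displacement of the base point [o] by [g], and [a_n]
    for the mean of [len] at the [n]-th position of the walk.  The proof bounds
    the escape rate from below by an expression in the [n]-step distribution
    alone, with constants that are uniform near the limit:
      [l >= ((1 - 2 * eta) * a_n - 2 * C) / n]        ([escape_rate_ge]).
    The right-hand side is lower semicontinuous by Fatou's lemma
    ([fatou_walk_exp]); at the limit it tends to [(1 - 2 * eta)] times the
    escape rate as [n] grows ([escape_rate_lt_mean]), and [eta] is arbitrary.

    The constants come from a shadow estimate: for [n] large, whatever the
    point [x], the [n]-th position [Z o] of the walk satisfies
    [gromov_product o x (Z o) > C] with probability at most [eta].  To prove it,
    take [N] words [s i] in two independent loxodromic elements, reached by the
    walk at the same time [M], such that for all [x] and [y] at most two of the
    points [s i y] can follow [x] for long ([schottky_card]).  Conditionally on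
    the first [M] steps being one of the [s i], chosen evenly, the bad event
    then has probability at most [2 / N]; otherwise one starts again with the
    remaining steps and a slightly smaller [C].  After enough rounds the
    walk has met such a choice and the probability is at most [4 / N]
    ([shadow_iter]).  This uses finitely many strict inequalities on the orbit
    of [o] and on the [M]-step distribution, hence holds with the same
    constants for all large indices ([uniform_shadow]).

    Given the estimate, cut the walk after [n] steps, at [g], and let [h] be
    the product of the next [m] steps:
      [len (g * h) = len g + len h - 2 * gromov_product o (g^-1 o) (h o)].
    As [h] is independent of [g], the Gromov product is at most [C] except with
    conditional probability [eta], and it never exceeds [len g].  Taking means,
    [a_(n + m) >= a_m + (1 - 2 * eta) * a_n - 2 * C]
    ([walk_exp_almost_superadditive]).  Because the error term is proportional
    to [a_n] itself, heavy tails of the step distributions do no harm.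

    It remains to compare means with the almost sure rate.  If the rate is
    finite then single steps are almost surely at most linear in their index,
    so by independence they have a finite mean ([escape_rate_finite_moment]),
    and uniform integrability gives [a_n <= r * n] for any [r > l] and [n] large
    ([escape_rate_mean]).

    The words [s i] are [a^r b^J a^t] for large powers [a], [b] of the two
    loxodromic elements, with [r + t] fixed.  Some power of a loxodromic
    element satisfies a local straightness condition, which implies that its
    orbits are rays converging to fixed boundary points; disjointness of these
    points bounds all Gromov products between powers of [a] and powers of [b]
    ([independent_transverse], [transverse_schottky]). *)

(** * Gromov products and straight isometries *)

Section GromovProduct.
Context {R : realType} {X : metricType R}.
Implicit Types (o x y z : X) (u v w : nat -> X).

Lemma gromov_productC o x y : gromov_product o x y = gromov_product o y x.
Proof. by rewrite /gromov_product (metric_sym x y) (addrC (mdist o x)). Qed.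

Lemma gromov_product_ge0 o x y : 0 <= gromov_product o x y.
Proof.
rewrite /gromov_product; have := metric_triangle x o y.
by rewrite (metric_sym x o); lra.
Qed.

Lemma gromov_product_lel o x y : gromov_product o x y <= mdist o x.
Proof.
by rewrite /gromov_product; have := metric_triangle o x y; lra.
Qed.

Lemma gromov_product_basel o y : gromov_product o o y = 0.
Proof. by rewrite /gromov_product mdistxx; lra. Qed.

(** The side from [o] to [x] of a tripod is cut at its centre into the Gromov
    products at [o] and at [x]. *)
Lemma gromov_product_swap o x y :
  gromov_product o x y = mdist o x - gromov_product x o y.
Proof. by rewrite /gromov_product (metric_sym x o); lra. Qed.

Lemma gromov_product_base o p x y :
  gromov_product o x y <= gromov_product p x y + mdist o p.
Proof.
rewrite /gromov_product.
have := metric_triangle o p x; have := metric_triangle o p y; lra.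
Qed.

Context {delta : R} (hyp : hyperbolic X delta).

(** Hyperbolicity in the form used below: an angle bounded away from zero
    between [x] and [z] persists when [z] is replaced by any [y] that follows
    [z] a little further than [x] does. *)
Lemma gromov_product_separate o x y z (A : R) :
  gromov_product o x z <= A -> A + delta < gromov_product o y z ->
  gromov_product o x y <= A + delta.
Proof.
move=> xz yz; have := hyp o x y z.
by rewrite minElt; case: ifP => _; lra.
Qed.

Lemma gromov_asymptoticC o u v :
  gromov_asymptotic o u v -> gromov_asymptotic o v u.
Proof.
by move=> uv A; have [N HN] := uv A; exists N => m n mN nN;
  rewrite gromov_productC; exact: HN.
Qed.

Lemma gromov_asymptotic_trans o u v w :
  gromov_asymptotic o u v -> gromov_asymptotic o v w ->
  gromov_asymptotic o u w.
Proof.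
move=> uv vw A.
have [N1 H1] := uv (A + delta); have [N2 H2] := vw (A + delta).
exists (maxn N1 N2) => m n; rewrite !geq_max => /andP[m1 m2] /andP[n1 n2].
have := H1 m (maxn N1 N2) m1 (leq_maxl _ _).
have := H2 (maxn N1 N2) n (leq_maxr _ _) n2.
have := hyp o (u m) (v (maxn N1 N2)) (w n).
by rewrite minElt; case: ifP => _; lra.
Qed.

Lemma boundary_class_eq o u v :
  gromov_asymptotic o u v -> boundary_class o u = boundary_class o v.
Proof.
move=> uv; apply/seteqP; split=> w [gw uw]; split=> //.
- by apply: gromov_asymptotic_trans uw; exact: gromov_asymptoticC.
- exact: gromov_asymptotic_trans uw.
Qed.

End GromovProduct.

Section IsometricAction.
Context {R : realType} {G : groupType} {X : metricType R}.
Context {rho : G -> X -> X} (iso : isometric_action rho).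
Implicit Types (o x y z : X) (g h : G).

Lemma action1 x : rho 1%g x = x. Proof. by case: iso. Qed.

Lemma actionM g h x : rho (g * h)%g x = rho g (rho h x).
Proof. by case: iso. Qed.

Lemma mdist_action g x y : mdist (rho g x) (rho g y) = mdist x y.
Proof. by case: iso. Qed.

Lemma actionVK g x : rho g (rho g^-1%g x) = x.
Proof. by rewrite -actionM mulgV action1. Qed.

Lemma mdist_actionl g x y : mdist (rho g x) y = mdist x (rho g^-1%g y).
Proof. by rewrite -(mdist_action g _ (rho g^-1%g y)) actionVK. Qed.

Lemma mdist_actionr g x y : mdist x (rho g y) = mdist (rho g^-1%g x) y.
Proof. by rewrite -(mdist_action g _ y) actionVK. Qed.

Lemma orbit_distV o g : mdist o (rho g^-1%g o) = mdist o (rho g o).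
Proof. by rewrite -mdist_actionl metric_sym. Qed.

Lemma orbit_distM o g h :
  mdist o (rho (g * h)%g o) <= mdist o (rho g o) + mdist o (rho h o).
Proof.
by rewrite actionM -(mdist_action g o (rho h o)); exact: metric_triangle.
Qed.

Lemma orbit_dist_sub o g h :
  mdist (rho g o) (rho h o) = mdist o (rho (g^-1 * h)%g o).
Proof. by rewrite actionM mdist_actionl. Qed.

Lemma gromov_product_action g o x y :
  gromov_product (rho g o) (rho g x) (rho g y) = gromov_product o x y.
Proof. by rewrite /gromov_product !mdist_action. Qed.

Lemma gromov_product_pull g o x y :
  gromov_product o (rho g x) (rho g y) = gromov_product (rho g^-1%g o) x y.
Proof. by rewrite -[RHS](gromov_product_action g) actionVK. Qed.

(** How long the geodesic from [o] to [g z] follows the one to [g o] is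
    decided by the angle at [o] between [g^-1 o] and [z]. *)
Lemma gromov_product_follow g o z :
  gromov_product o (rho g o) (rho g z) =
    mdist o (rho g o) - gromov_product o (rho g^-1%g o) z.
Proof.
rewrite gromov_product_swap; congr (_ - _).
by rewrite -(gromov_product_action g o) actionVK.
Qed.

Context {delta : R} (delta_ge0 : 0 <= delta) (hyp : hyperbolic X delta).

(** An isometry that turns back little compared with how far it moves [o];
    the orbit of [o] under its powers is then a quasi-geodesic. *)
Definition straight o g : Prop :=
  2 * gromov_product o (rho g^-1%g o) (rho g o) + 3 * delta + 1
    <= mdist o (rho g o).

Lemma straightV o g : straight o g -> straight o g^-1%g.
Proof. by rewrite /straight invgK orbit_distV gromov_productC. Qed.

Lemma straight_sqr o g :
  mdist o (rho g o) + 3 * delta + 1 <= mdist o (rho (g ^+ 2)%g o) ->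
  straight o g.
Proof.
rewrite /straight /gromov_product orbit_dist_sub invgK -expg2 orbit_distV.
lra.
Qed.

Section Straight.
Context {o : X} {g : G} (st : straight o g).
Let A := gromov_product o (rho g^-1%g o) (rho g o).
Let u n := rho (g ^+ n)%g o.

Let A_ge0 : 0 <= A. Proof. exact: gromov_product_ge0. Qed.

(** Local-to-global principle.  The orbit turns little at [u n.+1] by
    straightness, and the induction hypothesis at [u n] says that [o] lies
    behind [u n] when seen from [u n.+1]. *)
Lemma straight_turn n : gromov_product (u n) o (u n.+1) <= A + delta.
Proof.
elim: n => [|n IH].
  by rewrite /u expg0 action1 gromov_product_basel addr_ge0.
have turn : gromov_product (u n.+1) (u n.+2) (u n) <= A.
  have back : (g ^+ n.+1 * g^-1 = g ^+ n)%g by rewrite expgSr mulgK.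
  rewrite /A gromov_productC -(gromov_product_action (g ^+ n.+1)%g o) /u.
  by rewrite -!actionM back -expgSr.
have step : mdist (u n) (u n.+1) = mdist o (rho g o).
  by rewrite /u expgSr actionM mdist_action.
rewrite gromov_productC; apply: (gromov_product_separate hyp turn).
rewrite gromov_productC gromov_product_swap (metric_sym (u n.+1)) step.
by rewrite gromov_productC; move: IH st A_ge0 delta_ge0; rewrite /straight -/A; lra.
Qed.

Lemma straight_growth n : n%:R <= mdist o (u n).
Proof.
elim: n => [|n IH]; first exact: mdist_ge0.
have := straight_turn n; rewrite /gromov_product (metric_sym (u n) o).
have -> : mdist (u n) (u n.+1) = mdist o (rho g o).
  by rewrite /u expgSr actionM mdist_action.
by move: st IH A_ge0 delta_ge0; rewrite /straight -/A -(natr1 n); lra.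
Qed.

End Straight.

(** By the same local-to-global principle for [g^-1], the orbit after time
    [n.+1] lies ahead of its position at time [n.+1] when seen from its position
    at time [n]; hence it never comes back close to its past. *)
Lemma straight_ray o g : straight o g -> forall n m, (n <= m)%N ->
  mdist o (rho (g ^+ n)%g o)
    - (gromov_product o (rho g^-1%g o) (rho g o) + 2 * delta)
    <= gromov_product o (rho (g ^+ n)%g o) (rho (g ^+ m)%g o).
Proof.
move=> st n m; set A := gromov_product o (rho g^-1%g o) _.
have A0 : 0 <= A by exact: gromov_product_ge0.
rewrite gromov_product_swap lerD2l lerN2 leq_eqVlt => /predU1P[<-|nm].
  by rewrite gromov_productC gromov_product_basel; move: delta_ge0; lra.
have [r ->] : exists r, m = (n + r.+1)%N by exists (m - n.+1)%N; lia.
have -> : A + 2 * delta = (A + delta) + delta by lra.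
apply: (gromov_product_separate hyp (straight_turn st n)).
rewrite (expgnDr g n) (expgSr g n) !actionM gromov_product_action.
have := straight_turn (straightV st) r.
rewrite invgK (gromov_productC o (rho g o)) -/A.
rewrite -(gromov_product_action (g ^+ r.+1)%g).
have -> : rho (g ^+ r.+1)%g (rho (g^-1 ^+ r)%g o) = rho g o.
  by rewrite -actionM expVgn expgS mulgK.
have -> : rho (g ^+ r.+1)%g (rho (g^-1 ^+ r.+1)%g o) = o.
  by rewrite -actionM expVgn mulgV action1.
move=> turn; rewrite gromov_productC gromov_product_swap.
by rewrite gromov_productC in turn *; move: st; rewrite /straight -/A; lra.
Qed.

Lemma straight_gromov o g : straight o g ->
  gromov_sequence o (fun n => rho (g ^+ n)%g o).
Proof.
move=> st B; set A := gromov_product o (rho g^-1%g o) (rho g o).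
exists ((Num.trunc (B + (A + 2 * delta))).+1).
wlog mn : / forall m n, (m <= n)%N ->
    ((Num.trunc (B + (A + 2 * delta))).+1 <= m)%N ->
    B <= gromov_product o (rho (g ^+ m)%g o) (rho (g ^+ n)%g o).
  apply=> m n mn Nm; apply: le_trans (straight_ray st mn); rewrite -/A.
  have := straight_growth st m; have := truncnS_gt (B + (A + 2 * delta)).
  by move: Nm; rewrite -(ler_nat R); lra.
move=> m n Nm Nn; case: (leqP m n) => [le|/ltnW le]; first exact: mn.
by rewrite gromov_productC; exact: mn.
Qed.

(** Otherwise the lengths of the powers [g ^+ (2 ^ i)] would grow linearly
    in [i], against the quasi-isometric embedding of the cyclic group. *)
Lemma loxodromic_straight_power o g : loxodromic rho g ->
  exists2 p, (0 < p)%N & straight o (g ^+ p)%g.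
Proof.
move=> /(_ o)[la [c [la1 c0 qi]]].
pose a n := mdist o (rho (g ^+ n)%g o).
have growth n : n%:R / la - c <= a n.
  have := qi (Posz n) 0; rewrite subr0 ger0_norm // -pmulrn /= action1.
  by rewrite (metric_sym _ o) => /andP[].
apply: contrapT => nex.
pose K := 3 * delta + 1.
have small i : a (2 ^ i)%N <= a 1%N + i%:R * K.
  elim: i => [|i IH]; first by rewrite mul0r addr0.
  rewrite -natr1 mulrDl mul1r addrA; apply: le_trans (_ : a (2 ^ i)%N + K <= _).
    rewrite leNgt; apply/negP => lt; apply: nex; exists (2 ^ i)%N.
      by rewrite expn_gt0.
    apply: straight_sqr; rewrite -expgnA mulnC -expnS /a.
    by move: lt; rewrite /K /a; lra.
  by rewrite lerD2r.
pose T := la * (a 1%N + c + 2 * K).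
have a1_ge0 : 0 <= a 1%N by exact: mdist_ge0.
have K_ge0 : 0 <= K by rewrite /K; move: delta_ge0; lra.
pose i := (Num.trunc T).+2.
have Ti : T < i%:R.
  by apply: lt_trans (truncnS_gt T) _; rewrite ltr_nat.
have i1 : 1 <= i%:R :> R by rewrite ler1n.
have ii : i%:R * i%:R <= (2 ^ (2 * i))%:R :> R.
  rewrite -natrM ler_nat expnM mulnn -(expnM 2) mulnC expnM.
  by rewrite leq_exp2r// ltnW// ltn_expl.
have := le_trans (growth _) (small (2 * i)%N).
rewrite lerBlDr ler_pdivrMr ?(lt_le_trans ltr01)// => up.
have : i%:R * i%:R <= i%:R * T.
  apply: le_trans ii (le_trans up _); rewrite natrM /T mulrC mulrCA.
  rewrite ler_wpM2l ?(le_trans ler01)//.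
  have : a 1%N + c <= i%:R * (a 1%N + c) by rewrite ler_peMl// addr_ge0.
  by move: (i%:R) (a 1%N) => x y; lra.
rewrite ler_pM2l ?(lt_le_trans ltr01)//; lra.
Qed.

Lemma gromov_sequence_action o h (v : nat -> X) :
  gromov_sequence o v -> gromov_sequence o (rho h \o v).
Proof.
move=> gv B; have [N HN] := gv (B + mdist o (rho h o)).
exists N => m n mN nN; have := HN m n mN nN => /=.
rewrite gromov_product_pull -(orbit_distV o h).
have := gromov_product_base o (rho h^-1%g o) (v m) (v n); lra.
Qed.

(** An isometry commuting with [g] moves the orbit of [o] under the powers of
    [g] by a bounded amount, hence fixes its endpoint. *)
Lemma commute_boundary_fixed o g c : straight o g -> commute c g ->
  boundary_fixed_points o (rho c)
    (boundary_class o (fun n => rho (g ^+ n)%g o)).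
Proof.
move=> st cg; set u := fun n => _.
have gu : gromov_sequence o u by exact: straight_gromov.
have shift h : commute h g -> gromov_asymptotic o u (rho h \o u).
  move=> hg; apply: (gromov_asymptotic_trans hyp gu) => B.
  have [N HN] := gu (B + mdist o (rho h o)).
  exists N => m n mN nN; have := HN m n mN nN.
  have := metric_triangle (u m) (u n) (rho h (u n)).
  have : mdist (u n) (rho h (u n)) = mdist o (rho h o).
    by rewrite /u -actionM (commuteX n hg) actionM mdist_action.
  have := metric_triangle o (rho h (u n)) (u n).
  rewrite (metric_sym (rho h (u n)) (u n)) /gromov_product /=; lra.
have stable h : commute h g -> forall v, boundary_class o u v ->
    boundary_class o u (rho h \o v).
  move=> hg v [gv uv]; split; first exact: gromov_sequence_action.
  apply: (gromov_asymptotic_trans hyp (shift h hg)) => B.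
  have [N HN] := uv (B + mdist o (rho h o)).
  exists N => m n mN nN; have := HN m n mN nN => /=.
  rewrite gromov_product_pull -(orbit_distV o h).
  have := gromov_product_base o (rho h^-1%g o) (u m) (v n); lra.
split; first by exists u.
apply/seteqP; split=> [_ [v uv <-]|v uv]; first exact: stable.
exists (rho c^-1%g \o v).
  by apply: stable => //; apply/commute_sym/commuteV/commute_sym.
by apply/funext => n /=; rewrite actionVK.
Qed.

(** Two rays that follow each other for arbitrarily long share their
    endpoint. *)
Lemma straight_diverge o a b : straight o a -> straight o b ->
  boundary_class o (fun n => rho (a ^+ n)%g o) !=
    boundary_class o (fun n => rho (b ^+ n)%g o) ->
  exists B, forall i j,
    gromov_product o (rho (a ^+ i)%g o) (rho (b ^+ j)%g o) <= B.
Proof.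
move=> sa sb /eqP neq; apply: contrapT => unbounded; apply: neq.
apply: boundary_class_eq => // T.
pose A c := gromov_product o (rho c^-1%g o) (rho c o) + 2 * delta.
pose T' := T + A a + A b + 2 * delta.
have [i [j ij]] : exists i j,
    T' < gromov_product o (rho (a ^+ i)%g o) (rho (b ^+ j)%g o).
  apply: contrapT => none; apply: unbounded; exists T' => i j.
  by rewrite leNgt; apply/negP => lt; apply: none; exists i, j.
exists (maxn i j) => m n; rewrite !geq_max => /andP[im _] /andP[_ jn].
have := straight_ray sa im; have := straight_ray sb jn.
rewrite -/(A a) -/(A b) => Hb Ha.
have := gromov_product_lel o (rho (a ^+ i)%g o) (rho (b ^+ j)%g o).
have := gromov_product_lel o (rho (b ^+ j)%g o) (rho (a ^+ i)%g o).
rewrite (gromov_productC o (rho (b ^+ j)%g o)) => lb la.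
have := hyp o (rho (a ^+ m)%g o) (rho (a ^+ i)%g o) (rho (b ^+ j)%g o).
have := hyp o (rho (a ^+ m)%g o) (rho (b ^+ j)%g o) (rho (b ^+ n)%g o).
rewrite (gromov_productC o (rho (a ^+ m)%g o) (rho (a ^+ i)%g o)).
have A0 c : 0 <= A c.
  by rewrite addr_ge0 ?gromov_product_ge0 ?mulr_ge0.
move: (A0 a) (A0 b) delta_ge0 ij Ha Hb la lb; rewrite /T' !minElt.
by case: ifP => _; case: ifP => _; lra.
Qed.

(** Ping-pong data: seen from [o], a power of [a] and a power of [b], of
    either signs, point in different directions, and both kinds of powers go
    to infinity. *)
Definition transverse o (B : R) a b : Prop :=
  [/\ forall n, n%:R <= mdist o (rho (a ^+ n)%g o),
      forall n, n%:R <= mdist o (rho (b ^+ n)%g o)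
    & forall i j, forall c d, c \in [:: a; a^-1%g] -> d \in [:: b; b^-1%g] ->
       gromov_product o (rho (c ^+ i)%g o) (rho (d ^+ j)%g o) <= B].

Lemma independent_transverse o g h : independent_loxodromic rho o g h ->
  exists p q B, [/\ (0 < p)%N, (0 < q)%N & transverse o B (g ^+ p)%g (h ^+ q)%g].
Proof.
move=> [lg lh disj].
have [p p0 sp] := loxodromic_straight_power o lg.
have [q q0 sq] := loxodromic_straight_power o lh.
have diverge c d : straight o c -> straight o d -> commute g c ->
    commute h d -> exists B, forall i j,
    gromov_product o (rho (c ^+ i)%g o) (rho (d ^+ j)%g o) <= B.
  move=> sc sd gc hd; apply: straight_diverge => //; apply/eqP => eq.
  have : set0 (boundary_class o (fun n => rho (c ^+ n)%g o)).
    rewrite -disj; split; first exact: commute_boundary_fixed.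
    by rewrite eq; exact: commute_boundary_fixed.
  by [].
have cp : commute g (g ^+ p)%g by exact: commuteX.
have cq : commute h (h ^+ q)%g by exact: commuteX.
have cp' := commuteV cp; have cq' := commuteV cq.
have sp' := straightV sp; have sq' := straightV sq.
have [B1 H1] := diverge _ _ sp sq cp cq.
have [B2 H2] := diverge _ _ sp sq' cp cq'.
have [B3 H3] := diverge _ _ sp' sq cp' cq.
have [B4 H4] := diverge _ _ sp' sq' cp' cq'.
exists p, q, (Num.max (Num.max B1 B2) (Num.max B3 B4)).
split=> //; split; [exact: straight_growth|exact: straight_growth|].
move=> i j c d; rewrite !inE !le_max => /orP[]/eqP-> /orP[]/eqP->.
- by rewrite H1.
- by rewrite H2 orbT.
- by rewrite H3 orbT.
- by rewrite H4 !orbT.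
Qed.

End IsometricAction.

(** * Schottky families *)

Section Schottky.
Context {R : realType} {G : groupType} {X : metricType R}.
Context {rho : G -> X -> X} (iso : isometric_action rho).
Context {delta : R} (delta_ge0 : 0 <= delta) (hyp : hyperbolic X delta).
Implicit Types (o x y : X) (a b : G).

(** Schottky families, described by finitely many distances in the orbit of
    [o] so that they survive a small perturbation of the action. *)
Definition schottky o (A L : R) N (s : 'I_N -> G) : Prop :=
  (forall i j, i != j ->
     gromov_product o (rho (s i) o) (rho (s j) o) <= A /\
     gromov_product o (rho (s i)^-1%g o) (rho (s j)^-1%g o) <= A) /\
  forall i, L <= mdist o (rho (s i) o).

Lemma card_gromov_product_gt o A N (p : 'I_N -> X) z :
  (forall i j, i != j -> gromov_product o (p i) (p j) <= A) ->
  (#|[set i | (A + delta < gromov_product o (p i) z)%R]%SET| <= 1)%N.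
Proof.
move=> sep; apply/card_le1_eqP => i j; rewrite !inE => Hi Hj.
apply/esym/eqP/negPn/negP => ij; have := sep _ _ ij.
have := hyp o (p i) z (p j); rewrite (gromov_productC o z).
by rewrite minElt; case: ifP => _; lra.
Qed.

(** The word [s i] is so long that [s i y] follows [s i o] away from [o],
    unless [y] lies in the direction of [(s i)^-1 o], which happens for at
    most one [i]; and [x] lies in the direction of at most one [s i o]. *)
Lemma schottky_card o A L N (s : 'I_N -> G) x y :
  schottky o A L s -> 2 * A + 3 * delta < L ->
  (#|[set i | (A + 2 * delta < gromov_product o x (rho (s i) y))%R]%SET| <= 2)%N.
Proof.
move=> [sep len] AL.
pose U := [set i | A + delta < gromov_product o (rho (s i)^-1%g o) y]%SET.
pose V := [set i | A + delta < gromov_product o (rho (s i) o) x]%SET.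
have U1 : (#|U| <= 1)%N.
  by apply: card_gromov_product_gt => i j /sep[].
have V1 : (#|V| <= 1)%N.
  by apply: card_gromov_product_gt => i j /sep[].
apply: leq_trans (_ : #|(U :|: V)%SET| <= _)%N; last first.
  by rewrite (leq_trans (leq_card_setU U V).1)// (leq_add U1 V1).
apply/subset_leq_card/fintype.subsetP => i; rewrite !inE => Hi.
case: ltP => //= Ui.
have := gromov_product_follow iso (s i) o y.
have := hyp o (rho (s i) o) (rho (s i) y) x.
rewrite (gromov_productC o (rho (s i) y) x).
by have := len i; rewrite minElt; case: ifP => _; lra.
Qed.

Lemma transverseV o B a b :
  transverse (rho := rho) o B a b -> transverse (rho := rho) o B a^-1%g b^-1%g.
Proof.
move=> [ga gb ab]; split=> [n|n|i j c d].
- by rewrite expVgn orbit_distV.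
- by rewrite expVgn orbit_distV.
- by rewrite !invgK !inE orbC (orbC (d == _)) => Hc Hd; apply: ab; rewrite !inE.
Qed.

Definition pingpong a b (r J t : nat) : G := (a ^+ r * b ^+ J * a ^+ t)%g.

Lemma pingpongV a b r J t :
  (pingpong a b r J t)^-1%g = pingpong a^-1%g b^-1%g t J r.
Proof. by rewrite /pingpong !invgM !expVgn mulgA. Qed.

(** After the common prefix [a ^+ r], one word turns into the direction of
    [b] while the other keeps following [a]. *)
Lemma pingpong_separate o B a b r s J t t' :
  transverse (rho := rho) o B a b ->
  (r <= s)%N -> 2 * B + 3 * delta < (s - r)%:R -> 2 * B + 2 * delta < J%:R ->
  gromov_product o (rho (pingpong a b r J t) o) (rho (pingpong a b s J t') o)
    <= mdist o (rho (a ^+ r)%g o) + B + 2 * delta.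
Proof.
move=> [ga gb ab] rs srB JB.
have aa : a \in [:: a; a^-1%g] by rewrite inE eqxx.
have aV : a^-1%g \in [:: a; a^-1%g] by rewrite !inE eqxx orbT.
have bb : b \in [:: b; b^-1%g] by rewrite inE eqxx.
have bV : b^-1%g \in [:: b; b^-1%g] by rewrite !inE eqxx orbT.
pose y k := rho (b ^+ J)%g (rho (a ^+ k)%g o).
have along k : B + delta < gromov_product o (y k) (rho (b ^+ J)%g o).
  rewrite gromov_productC (gromov_product_follow iso) -expVgn.
  have := ab k J _ _ aa bV; rewrite gromov_productC.
  by move: (gb J) delta_ge0; lra.
pose z := rho (a ^+ (s - r))%g (y t').
have yB : gromov_product o (rho (a ^+ (s - r))%g o) (y t) <= B + delta.
  exact: gromov_product_separate (ab _ _ _ _ aa bb) (along t).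
have zB : B + delta + delta < gromov_product o z (rho (a ^+ (s - r))%g o).
  rewrite gromov_productC (gromov_product_follow iso) -expVgn.
  have := gromov_product_separate hyp (ab (s - r)%N _ _ _ aV bb) (along t').
  by move: (ga (s - r)%N) delta_ge0; lra.
rewrite gromov_productC in yB.
have := gromov_product_separate hyp yB zB.
rewrite /z /pingpong -[in (a ^+ s)%g](subnKC rs) expgnDr !(actionM iso).
rewrite (gromov_product_pull iso) => yz.
have := gromov_product_base (rho (a ^+ r)^-1%g o) o (y t) z.
rewrite (metric_sym _ o) (orbit_distV iso) /z /y.
move: yz; rewrite /z /y; lra.
Qed.

(** The words [a ^+ (E i) b ^+ J a ^+ (E (N - i))] share neither a long prefix
    nor a long suffix; their long middle part makes all displacements large
    compared with the Gromov products, and their letter counts agree. *)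
Lemma transverse_schottky o B a b N (K : R) : transverse (rho := rho) o B a b ->
  exists A r J t, [/\ 0 <= A,
    forall i j : 'I_N, (r i + t i = r j + t j)%N &
    schottky o A (2 * A + K) (fun i : 'I_N => pingpong a b (r i) J (t i))].
Proof.
move=> tr; have [ga gb ab] := tr.
have B0 : 0 <= B.
  by apply: le_trans (ab 0%N 0%N a b _ _); rewrite ?gromov_product_ge0 ?inE ?eqxx.
pose E := (Num.trunc (2 * B + 3 * delta)).+1.
pose r (i : 'I_N) := (E * i)%N.
pose t (i : 'I_N) := (E * (N - i))%N.
pose D c := \sum_(i < N.+1) mdist o (rho (c ^+ (E * i))%g o).
have D0 c : 0 <= D c by apply: sumr_ge0 => i _; exact: mdist_ge0.
have DP c (i : nat) : (i <= N)%N -> mdist o (rho (c ^+ (E * i))%g o) <= D c.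
  rewrite -ltnS => iN; rewrite /D (bigD1 (Ordinal iN))//= lerDl.
  by apply: sumr_ge0 => j _; exact: mdist_ge0.
have DV : D a^-1%g = D a.
  by apply: eq_bigr => i _; rewrite expVgn orbit_distV.
(* [D a] bounds the displacement of every prefix and suffix. *)
pose A := D a + B + 2 * delta.
pose J := (Num.trunc (2 * B + 2 * delta + 2 * A + `|K| + 2 * D a)).+1.
have JP : 2 * B + 2 * delta + 2 * A + `|K| + 2 * D a < J%:R.
  exact: truncnS_gt.
have A0 : 0 <= A by move: (D0 a) B0 delta_ge0; rewrite /A; lra.
have JB : 2 * B + 2 * delta < J%:R.
  by move: JP A0 (D0 a) (normr_ge0 K); lra.
have EP k l : (k < l)%N -> 2 * B + 3 * delta < (E * l - E * k)%:R.
  move=> kl; apply: lt_le_trans (truncnS_gt _) _.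
  by rewrite ler_nat -mulnBr leq_pmulr// subn_gt0.
have sep c d : transverse (rho := rho) o B c d -> D c = D a ->
    forall k l m n, (k < l <= N)%N ->
    gromov_product o (rho (pingpong c d (E * k) J m) o)
      (rho (pingpong c d (E * l) J n) o) <= A.
  move=> cd Dc k l m n /andP[kl lN].
  have := pingpong_separate m n cd _ (EP _ _ kl) JB; rewrite leq_mul2l ltnW ?orbT//.
  have := DP c k (leq_trans (ltnW kl) lN); rewrite Dc /A => H /(_ isT); lra.
exists A, r, J, t; split=> //.
  by move=> i j; rewrite /r /t -!mulnDr !subnKC// ltnW.
split=> [i j|i].
  wlog ij : i j / (i < j)%N => [wl|_].
    rewrite neq_ltn => /orP[ij|ji]; first by apply: wl; rewrite ?neq_ltn ?ij.
    have [] := wl j i ji; first by rewrite neq_ltn ji.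
    by split; rewrite gromov_productC.
  split; first by apply: sep => //; rewrite ij ltnW.
  rewrite gromov_productC !pingpongV; apply: sep => //; first exact: transverseV.
  by rewrite leq_subr andbT; move: (ltn_ord j) (ltn_ord i); lia.
have := orbit_distM iso o (a ^- r i) (pingpong a b (r i) J (t i) * a ^- t i)%g.
rewrite /pingpong mulgK mulgA mulVg mul1g !orbit_distV//.
have := orbit_distM iso o (pingpong a b (r i) J (t i)) (a ^- t i)%g.
have := DP a i (ltnW (ltn_ord i)); have := DP a (N - i)%N (leq_subr _ _).
rewrite /pingpong mulgK !orbit_distV// -/(r i) -/(t i).
by move: (gb J) JP (ler_norm K) B0 delta_ge0; lra.
Qed.

End Schottky.

(** * Expectations along a walk on a countable group *)

Section LimInf.
Context {R : realType}.
Implicit Types (u v : (\bar R)^nat) (x y : \bar R).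
Local Open Scope ereal_scope.

Lemma lee_fin_lt x y : (forall a : R, a%:E < x -> a%:E <= y) -> x <= y.
Proof.
case: x => [r| |] H; last by rewrite leNye.
- case: y H => [s| |] H; rewrite ?leey//.
    rewrite lee_fin leNgt; apply/negP => sr.
    have /= := H ((r + s) / 2)%R; rewrite lte_fin lee_fin => /(_ _); lra.
  by have := H (r - 1)%R; rewrite lte_fin ltrBlDr ltrDl ltr01 => /(_ isT).
- case: y H => [s| |] H; rewrite ?leey//.
    by have := H (s + 1)%R; rewrite ltry lee_fin => /(_ isT) ?; exfalso; lra.
  by have := H 0%R; rewrite ltry => /(_ isT).
Qed.

Lemma limn_einf_ge u x : (\forall k \near \oo, x <= u k) -> x <= limn_einf u.
Proof.
move=> [N _ HN]; rewrite limn_einf_lim; apply: lime_ge; first exact: is_cvg_einfs.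
exists N => // n /= Nn; apply: le_ereal_inf_tmp => _ [k /= nk <-].
by apply: HN => /=; exact: leq_trans nk.
Qed.

Lemma limn_einf_gt u x : x < limn_einf u -> \forall k \near \oo, x < u k.
Proof.
rewrite limn_einf_lim (cvg_lim _ (@cvg_einfs_sup _ u))//.
move=> /ereal_sup_gt[_ [N _ <-] aN]; exists N => // k /= Nk.
by apply: lt_le_trans aN _; apply: ereal_inf_lbound; exists k.
Qed.

Lemma limn_einf_le u v :
  (\forall k \near \oo, u k <= v k) -> limn_einf u <= limn_einf v.
Proof.
move=> uv; apply: lee_fin_lt => a /limn_einf_gt au; apply: limn_einf_ge.
by near=> k; apply: le_trans (ltW _) (_ : u k <= _); near: k.
Unshelve. all: by end_near. Qed.

Lemma limn_einf_mul u v (b : R) : (0 <= b)%R -> (forall k, 0 <= u k) ->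
  (forall k, 0 <= v k) -> v k @[k --> \oo] --> b%:E ->
  limn_einf u * b%:E <= limn_einf (fun k => u k * v k).
Proof.
move=> b0 u0 v0 vb.
have uv0 : 0 <= limn_einf (fun k => u k * v k).
  by apply: limn_einf_ge; apply: nearW => k; exact: mule_ge0.
have [->|bn0] := eqVneq b 0%R; first by rewrite mule0.
have b_gt0 : (0 < b)%R by rewrite lt_neqAle eq_sym bn0.
rewrite -lee_pdivlMr//; apply: lee_fin_lt => a au; rewrite lee_pdivlMr//.
have [a0|a0] := ltP a 0%R.
  by apply: le_trans uv0; rewrite -EFinM lee_fin mulr_le0_ge0// ltW.
have av : (a%:E * v k) @[k --> \oo] --> a%:E * b%:E.
  by apply: cvgeZl => //.
rewrite -(cvg_limn_einf_sup av).1; apply: limn_einf_le.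
have ua := limn_einf_gt au.
near=> k; rewrite lee_wpmul2r//.
by apply/ltW; near: k.
Unshelve. all: by end_near. Qed.

End LimInf.

Section CountableGroup.
Context {R : realType} {G : groupType}.
Context {c : G -> nat} (c_inj : injective c).
Local Open Scope ereal_scope.

(** The atoms of [G], listed along an injection into the integers; the list
    has gaps, filled by the empty set. *)
Definition fiber (i : nat) : set (discr G) := [set g | c g = i].

Lemma fiberP i : fiber i = set0 \/ exists g : G, fiber i = [set (g : discr G)].
Proof.
have [[g gi]|none] := pselect (exists g, c g = i); [right|left].
  exists g; apply/seteqP; split=> [h /= hi|h ->//].
  by apply: c_inj; rewrite gi.
by apply/seteqP; split=> // h hi; apply: none; exists h.
Qed.

Lemma trivIset_fiber : trivIset setT fiber.
Proof. by move=> i j _ _ [g [/= <- <-]]. Qed.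

Lemma bigcup_fiber : \bigcup_i fiber i = setT.
Proof. by apply/seteqP; split=> // g _; exists (c g). Qed.

Implicit Types (mu : probability (discr G) R) (f : G -> \bar R).

Lemma integral_fiber mu f i (g : G) : fiber i = [set (g : discr G)] ->
  \int[mu]_(x in fiber i) f x = f g * mu [set (g : discr G)].
Proof.
move=> ->; rewrite -integral_cst//; apply: eq_integral => x.
by rewrite inE => ->.
Qed.

Lemma integral_discr mu f : (forall g, 0 <= f g) ->
  \int[mu]_x f x = \sum_(i <oo) \int[mu]_(x in fiber i) f x.
Proof.
move=> f0; rewrite -bigcup_fiber ge0_integral_bigcup//.
exact: trivIset_fiber.
Qed.

(** On a countable set, integrals against varying measures are sums over
    atoms, so this is Fatou's lemma for the counting measure. *)
Lemma fatou_discr (mu : nat -> probability (discr G) R)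
    (mu_oo : probability (discr G) R) (f : nat -> G -> \bar R) :
  (forall g : G, mu k [set g] @[k --> \oo] --> mu_oo [set g]) ->
  (forall k g, 0 <= f k g) ->
  \int[mu_oo]_x limn_einf (f ^~ x) <= limn_einf (fun k => \int[mu k]_x f k x).
Proof.
move=> cvg f0.
have lf0 g : 0 <= limn_einf (f^~ g) by apply: limn_einf_ge; exact: nearW.
pose t k i := \int[mu k]_(x in fiber i) f k x.
have t0 k i : 0 <= t k i by exact: integral_ge0.
rewrite integral_discr//.
apply: (@le_trans _ _ (\int[counting]_i limn_einf (t ^~ i))).
  rewrite ge0_integral_count; last first.
    by move=> i; apply: limn_einf_ge; exact: nearW.
  apply: lee_nneseries => [i _ _|i _]; first exact: integral_ge0.
  have [->|[g gi]] := fiberP i.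
    by rewrite integral_set0; apply: limn_einf_ge; exact: nearW.
  rewrite (integral_fiber _ _ gi) -[mu_oo _]fineK ?fin_num_measure//.
  under [X in _ <= limn_einf X]funext do rewrite /t (integral_fiber _ _ gi).
  by apply: limn_einf_mul => //; rewrite ?fine_ge0// fineK ?fin_num_measure.
apply: le_trans (fatou _ _ _ _) _ => //.
apply: limn_einf_le; apply: nearW => k.
by rewrite ge0_integral_count// integral_discr.
Qed.

(** The expectation of [f (g_1 ... g_n)] as an iterated integral.  In this form
    it does not depend on the probability space that carries the walk, it
    splits after any number of steps, and Fatou's lemma goes through one
    integral at a time. *)
Fixpoint walk_exp mu n f : \bar R :=
  if n is m.+1 then \int[mu]_g walk_exp mu m (fun h => f (g * h)%g)
  else f 1%g.

Lemma walk_exp_ge0 mu n f : (forall g, 0 <= f g) -> 0 <= walk_exp mu n f.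
Proof.
by elim: n f => [|n IH] f f0 //=; apply: integral_ge0 => g _; exact: IH.
Qed.

Lemma le_walk_exp mu n f1 f2 : (forall g, 0 <= f1 g) ->
  (forall g, f1 g <= f2 g) -> walk_exp mu n f1 <= walk_exp mu n f2.
Proof.
elim: n f1 f2 => [|n IH] f1 f2 f10 f12 //=.
by apply: ge0_le_integral => // g _; [exact: walk_exp_ge0|exact: IH].
Qed.

Lemma walk_expD mu n f1 f2 : (forall g, 0 <= f1 g) -> (forall g, 0 <= f2 g) ->
  walk_exp mu n (fun g => f1 g + f2 g) = walk_exp mu n f1 + walk_exp mu n f2.
Proof.
elim: n f1 f2 => [|n IH] f1 f2 f10 f20 //=.
rewrite -ge0_integralD//; try by move=> g _; exact: walk_exp_ge0.
by apply: eq_integral => g _; rewrite IH.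
Qed.

Lemma walk_exp_sum mu n N (f : 'I_N -> G -> \bar R) : (forall i g, 0 <= f i g) ->
  walk_exp mu n (fun g => \sum_(i < N) f i g) = \sum_(i < N) walk_exp mu n (f i).
Proof.
elim: n f => [|n IH] f f0 //=.
rewrite -ge0_integral_sum//; last by move=> i g _; exact: walk_exp_ge0.
by apply: eq_integral => g _; rewrite IH.
Qed.

Lemma walk_expZ mu n (a : R) f : (0 <= a)%R -> (forall g, 0 <= f g) ->
  walk_exp mu n (fun g => a%:E * f g) = a%:E * walk_exp mu n f.
Proof.
move=> a0; elim: n f => [|n IH] f f0 //=.
rewrite -ge0_integralZl//; last by move=> g _; exact: walk_exp_ge0.
by apply: eq_integral => g _; rewrite IH.
Qed.

Lemma walk_exp_cst mu n (a : \bar R) : walk_exp mu n (fun=> a) = a.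
Proof.
elim: n => [|n IH] //=.
under eq_integral do rewrite IH.
by rewrite integral_cst// [X in _ * X]probability_setT mule1.
Qed.

Lemma eq_walk_exp mu n f1 f2 : f1 =1 f2 -> walk_exp mu n f1 = walk_exp mu n f2.
Proof. by move=> /funext ->. Qed.

Lemma walk_exp_cat mu n m f : walk_exp mu (n + m) f =
  walk_exp mu n (fun g => walk_exp mu m (fun h => f (g * h)%g)).
Proof.
elim: n f => [|n IH] f /=; first by apply: eq_walk_exp => h; rewrite mul1g.
apply: eq_integral => g _; rewrite IH; apply: eq_walk_exp => h.
by apply: eq_walk_exp => h'; rewrite mulgA.
Qed.

Lemma fatou_walk_exp (mu : nat -> probability (discr G) R)
    (mu_oo : probability (discr G) R) n
    (f : nat -> G -> \bar R) :
  (forall g : G, mu k [set g] @[k --> \oo] --> mu_oo [set g]) ->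
  (forall k g, 0 <= f k g) ->
  walk_exp mu_oo n (fun g => limn_einf (f ^~ g))
    <= limn_einf (fun k => walk_exp (mu k) n (f k)).
Proof.
move=> cvg; elim: n f => [|n IH] f f0 //=.
apply: le_trans (fatou_discr cvg _); last by move=> k g; exact: walk_exp_ge0.
apply: ge0_le_integral => // g _.
  by apply: walk_exp_ge0 => h; apply: limn_einf_ge; exact: nearW.
exact: IH.
Qed.

End CountableGroup.

Arguments fiber {G} c i.

(** * The walk on its probability space *)

Section WalkLaw.
Context {R : realType} {G : groupType}.
Context {c : G -> nat} (c_inj : injective c).
Context {d : measure_display} {Omega : measurableType d}.
Context {P : probability Omega R}.
Context {mu : probability (discr G) R} {xi : nat -> {RV P >-> discr G}}.
Context (xi_iid : iid mu xi).
Local Open Scope ereal_scope.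

Lemma measurable_mulg (u v : Omega -> discr G) :
  measurable_fun setT u -> measurable_fun setT v ->
  measurable_fun setT (fun w => (u w : G) * (v w : G) : discr G)%g.
Proof.
move=> mu' mv _ Y _; rewrite setTI.
rewrite (_ : _ @^-1` Y = \bigcup_i (u @^-1` fiber c i `&`
    v @^-1` [set h | exists2 g : G, c g = i & Y (g * (h : G))%g])).
  apply: bigcupT_measurable => i; apply: measurableI.
  - by rewrite -[X in measurable X]setTI; exact: mu'.
  - by rewrite -[X in measurable X]setTI; exact: mv.
apply/seteqP; split=> w /=.
  by move=> Yw; exists (c (u w)) => //; split=> //; exists (u w).
by move=> [i _ [ui [g gi Yg]]]; rewrite (_ : u w = g)//; apply: c_inj; rewrite gi.
Qed.

Lemma measurable_walk m n :
  measurable_fun setT (walk (fun i => xi (m + i)%N) n : Omega -> discr G).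
Proof.
elim: n => [|n IH].
  rewrite (_ : walk _ 0 = cst 1%g); first exact: measurable_cst.
  by apply/funext => w; rewrite /walk big_ord0.
rewrite (_ : walk _ n.+1 =
    fun w => (walk (fun i => xi (m + i)%N) n w * (xi (m + n)%N w : G))%g).
  exact: measurable_mulg.
by apply/funext => w; rewrite /walk big_ord_recr.
Qed.

Definition cylinder (J : {fset nat}) (A : nat -> set (discr G)) : set Omega :=
  \bigcap_(i in [set` J]) (xi i @^-1` A i).

Lemma measurable_step i (A : set (discr G)) : measurable (xi i @^-1` A).
Proof. by rewrite -[X in measurable X]setTI; exact: measurable_funP. Qed.

Lemma measurable_cylinder J A : measurable (cylinder J A).
Proof.
by apply: bigcap_measurableType => i _; exact: measurable_step.
Qed.

Lemma cylinderU1 J A m (B : set (discr G)) : (forall i, i \in J -> (i < m)%N) ->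
  cylinder (m |` J)%fset (fun i => if i == m then B else A i) =
  cylinder J A `&` xi m @^-1` B.
Proof.
move=> Jm; rewrite /cylinder bigcap_fsetU1 eqxx setIC; congr (_ `&` _).
apply: eq_bigcapr => i /= iJ; rewrite ifN//.
by rewrite neq_ltn Jm.
Qed.

Lemma cylinder_step J A m (B : set (discr G)) :
  (forall i, i \in J -> (i < m)%N) ->
  P (cylinder J A `&` xi m @^-1` B) = P (cylinder J A) * mu B.
Proof.
move=> Jm; have [ind law] := xi_iid.
rewrite -cylinderU1// /cylinder !ind big_fsetU1/=; last first.
  by apply/negP => /Jm; rewrite ltnn.
rewrite eqxx muleC -(law m B); congr (_ * _).
by apply: eq_big_seq => i iJ; rewrite ifN// neq_ltn Jm.
Qed.

Lemma walkS m n w : walk (fun i => xi (m + i)%N) n.+1 w =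
  ((xi m w : G) * walk (fun i => xi (m.+1 + i)%N) n w)%g.
Proof.
rewrite /walk big_ord_recl addn0; congr (_ * _)%g.
by apply: eq_bigr => i _; rewrite lift0 addSnnS.
Qed.

Lemma measurable_walk_fun m n (f : G -> \bar R) D :
  measurable_fun D (fun w => f (walk (fun i => xi (m + i)%N) n w)).
Proof.
apply: measurable_funTS.
have mf : measurable_fun [set: discr G] (f : discr G -> \bar R) by [].
exact: measurableT_comp mf (measurable_walk m n).
Qed.

Lemma measurable_step_fun i (f : G -> \bar R) D :
  measurable_fun D (fun w => f (xi i w)).
Proof.
apply: measurable_funTS.
have mf : measurable_fun [set: discr G] (f : discr G -> \bar R) by [].
exact: measurableT_comp mf (measurable_funP (xi i)).
Qed.

(** Conditionally on a step [xi m = g] the rest of the walk is independent of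
    what came before and its position is multiplied by [g]; summing over the
    countably many values of [g] unfolds one integral of [walk_exp]. *)
Lemma integral_cylinder_walk n m (J : {fset nat}) A (f : G -> \bar R) :
  (forall i, i \in J -> (i < m)%N) -> (forall g, 0 <= f g) ->
  \int[P]_(w in cylinder J A) f (walk (fun i => xi (m + i)%N) n w) =
    P (cylinder J A) * walk_exp mu n f.
Proof.
elim: n m J A f => [|n IH] m J A f Jm f0.
  rewrite muleC -integral_cst; last exact: measurable_cylinder.
  by apply: eq_integral => w _; rewrite /walk big_ord0.
pose Fi i := cylinder J A `&` xi m @^-1` fiber c i.
have mFi i : measurable (Fi i).
  by apply: measurableI; [exact: measurable_cylinder|exact: measurable_step].
have -> : cylinder J A = \bigcup_i Fi i.
  by rewrite -setI_bigcupr -preimage_bigcup bigcup_fiber preimage_setT setIT.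
rewrite ge0_integral_bigcup//; last 2 first.
- exact: measurable_walk_fun.
- move=> i j _ _ [w [[_ /= wi] [_ /= wj]]].
  by apply: (trivIset_fiber (c := c)) => //; exists (xi m w).
rewrite -setI_bigcupr -preimage_bigcup bigcup_fiber preimage_setT setIT.
rewrite /= (@integral_discr _ _ c); last by move=> g; exact: walk_exp_ge0.
rewrite -[P _]fineK ?fin_num_measure//; last exact: measurable_cylinder.
rewrite -nneseriesZl; last first.
  by move=> i _; apply: integral_ge0 => g _; exact: walk_exp_ge0.
rewrite fineK ?fin_num_measure//; last exact: measurable_cylinder.
apply: eq_eseriesr => i _.
have [i0|[g gi]] := fiberP c_inj i.
  by rewrite /Fi i0 preimage_set0 setI0 !integral_set0 mule0.
rewrite (integral_fiber _ _ gi) (muleC (walk_exp _ _ _)) muleA /Fi gi.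
rewrite -(cylinder_step _ _ Jm) -(cylinderU1 _ _ Jm) -(IH m.+1)//; last first.
  move=> j; rewrite in_fset1U => /predU1P[->//|/Jm jm].
  exact: ltn_trans jm _.
apply: eq_integral => w; rewrite inE cylinderU1// => -[_ /= wg].
by rewrite walkS wg.
Qed.

Lemma integral_shifted_walk m n (f : G -> \bar R) : (forall g, 0 <= f g) ->
  \int[P]_w f (walk (fun i => xi (m + i)%N) n w) = walk_exp mu n f.
Proof.
move=> f0; have := @integral_cylinder_walk n m fset0 (fun=> setT) f.
rewrite (_ : cylinder fset0 _ = setT) ?probability_setT ?mul1e; last first.
  by apply/seteqP; split.
by apply.
Qed.

Lemma integral_walk n (f : G -> \bar R) : (forall g, 0 <= f g) ->
  \int[P]_w f (walk xi n w) = walk_exp mu n f.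
Proof. exact: (integral_shifted_walk 0). Qed.

Lemma integral_step i (f : G -> \bar R) : (forall g, 0 <= f g) ->
  \int[P]_w f (xi i w) = walk_exp mu 1 f.
Proof.
move=> f0; rewrite -(integral_shifted_walk i)//; apply: eq_integral => w _.
by rewrite walkS /walk big_ord0 mulg1.
Qed.

End WalkLaw.

(** * Shadow estimate and almost superadditivity *)

Section WalkProb.
Context {R : realType} {G : groupType}.
Implicit Types (mu : probability (discr G) R) (p : pred G).
Local Open Scope ereal_scope.

Definition walk_prob mu n p : \bar R := walk_exp mu n (fun g => ((p g)%:R)%:E).

Lemma walk_prob_ge0 mu n p : 0 <= walk_prob mu n p.
Proof. by apply: walk_exp_ge0 => g; rewrite lee_fin. Qed.

Lemma le_walk_prob mu n p q : subpred p q -> walk_prob mu n p <= walk_prob mu n q.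
Proof.
move=> pq; apply: le_walk_exp => g; rewrite lee_fin ?ler0n//.
by have := pq g; case: (p g) => [/(_ isT) ->|_]; rewrite ?ler0n.
Qed.

Lemma walk_probC mu n p : walk_prob mu n p + walk_prob mu n (predC p) = 1.
Proof.
rewrite /walk_prob -walk_expD; try by move=> g; rewrite lee_fin.
rewrite -[RHS](walk_exp_cst mu n 1); apply: eq_walk_exp => g /=.
by case: (p g); rewrite ?adde0 ?add0e.
Qed.

Lemma walk_prob_le1 mu n p : walk_prob mu n p <= 1.
Proof. by rewrite -(walk_probC mu n p) leeDl// walk_prob_ge0. Qed.

Lemma walk_prob_fin mu n p : walk_prob mu n p \is a fin_num.
Proof.
rewrite ge0_fin_numE ?walk_prob_ge0//.
by apply: le_lt_trans (walk_prob_le1 mu n p) _; exact: ltry.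
Qed.

Lemma walk_prob_compl_le mu n p q (a : R) : q =1 predC p ->
  (1 - a)%:E < walk_prob mu n p -> walk_prob mu n q <= a%:E.
Proof.
move=> qp; have -> : walk_prob mu n q = walk_prob mu n (predC p).
  by apply: eq_walk_exp => g; rewrite qp.
have := walk_probC mu n p.
rewrite -(fineK (walk_prob_fin mu n p)) -(fineK (walk_prob_fin mu n (predC p))).
by rewrite -EFinD => -[]; rewrite lte_fin lee_fin; lra.
Qed.

End WalkProb.

#[local] Hint Resolve mdist_ge0 : core.

Section Shadow.
Context {R : realType} {G : groupType} {X : metricType R}.
Context {rho : G -> X -> X} (iso : isometric_action rho).
Context {delta : R} (delta_ge0 : 0 <= delta) (hyp : hyperbolic X delta).
Context {mu : probability (discr G) R} {o : X}.

(** Condition on the first [M] steps.  If they form one of the words [s i],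
    each of which has mass at least [a0], the remaining walk has to enter a
    shadow depending on [i]; a given point lies in at most two of these [N]
    shadows, so their probabilities sum to at most two.  Otherwise the
    displacement is at most [D], up to probability [a0], and the previous bound
    applies with the threshold lowered by [D]. *)
Lemma shadow_iter N (s : 'I_N -> G) (A L a0 D : R) M :
  (0 < N)%N -> 0 <= A -> schottky (rho := rho) o A L s -> 2 * A + 3 * delta < L ->
  0 < a0 -> 0 <= D ->
  (forall i, a0%:E <= walk_prob mu M (pred1 (s i)))%E ->
  (forall i, mdist o (rho (s i) o) <= D) ->
  (walk_prob mu M (fun g => (D < mdist o (rho g o))%R) <= a0%:E)%E ->
  forall T n x, (walk_prob mu (T * M + n)
      (fun g => (A + 2 * delta + T%:R * D < gromov_product o x (rho g o))%R)
    <= (Num.max (4 / N%:R) (1 - T%:R * a0))%:E)%E.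
Proof.
move=> N0 A0 sch AL a0_gt0 D0 atom sD far; elim=> [|T IH] n x.
  apply: le_trans (walk_prob_le1 _ _ _) _.
  by rewrite lee_fin le_max mul0r subr0 lexx orbT.
set b := Num.max _ _ in IH; set C := _ + _ * D.
have N_gt0 : 0 < N%:R :> R by rewrite ltr0n.
have b_ge : 4 / N%:R <= b by rewrite le_max lexx.
have b0 : 0 <= b by apply: le_trans b_ge; rewrite divr_ge0.
have s_inj : injective s.
  move=> i j ij; apply/eqP/negPn/negP => /(sch.1 i j)[+ _].
  have := sch.2 j; rewrite ij /gromov_product mdistxx.
  by move: delta_ge0 A0; lra.
pose q g := walk_prob mu (T * M + n)
  (fun h => C < gromov_product o x (rho (g * h)%g o)).
have qfin g : q g \is a fin_num by exact: walk_prob_fin.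
pose qr g := fine (q g).
have q1 g : qr g <= 1 by rewrite -lee_fin fineK// walk_prob_le1.
have qb g : mdist o (rho g o) <= D -> qr g <= b.
  move=> gD; rewrite -lee_fin fineK//; apply: le_trans (IH n (rho g^-1%g x)).
  apply: le_walk_prob => h; rewrite /C -natr1 mulrDl mul1r => Ch.
  have := gromov_product_base (rho g^-1%g o) o (rho g^-1%g x) (rho h o).
  rewrite -(gromov_product_pull iso) (actionVK iso) -(actionM iso).
  rewrite (metric_sym _ o) (orbit_distV iso).
  by move: Ch gD; lra.
rewrite mulSn -addnA /walk_prob walk_exp_cat.
set v := walk_exp mu M _.
have vE : v = walk_exp mu M (fun g => (qr g)%:E).
  by apply: eq_walk_exp => g; rewrite fineK.
have sum2 : \sum_(i < N) qr (s i) <= 2.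
  rewrite -lee_fin -sumEFin; under eq_bigr do rewrite fineK//.
  rewrite -walk_exp_sum; last by move=> i g; rewrite lee_fin.
  rewrite -[leRHS](walk_exp_cst mu (T * M + n)); apply: le_walk_exp => h.
    by apply: sume_ge0 => i _; rewrite lee_fin.
  rewrite sumEFin lee_fin -natr_sum ler_nat.
  apply: leq_trans _ (schottky_card iso hyp x (rho h o) sch AL).
  rewrite -sum1_card [leqRHS]big_mkcond/= leq_sum// => i _.
  rewrite inE -(actionM iso); case: ltP => // Ci.
  rewrite ifT//; apply: le_lt_trans Ci.
  by rewrite /C lerDl mulr_ge0.
(* At [s i] the crude bound [b] on the conditional probability exceeds the true
   value [qr (s i)] by [t i (s i)]; these savings are subtracted below. *)
pose t i g : R := (b - qr (s i)) * (g == s i)%:R.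
have t0 i g : 0 <= t i g by rewrite mulr_ge0// subr_ge0 qb.
have key : (v + \sum_(i < N) (b - qr (s i))%:E * walk_prob mu M (pred1 (s i))
    <= b%:E + walk_prob mu M (fun g => (D < mdist o (rho g o))%R))%E.
  have -> : (\sum_(i < N) (b - qr (s i))%:E * walk_prob mu M (pred1 (s i)) =
      walk_exp mu M (fun g => \sum_(i < N) (t i g)%:E))%E.
    rewrite walk_exp_sum//; apply: eq_bigr => i _.
    rewrite -walk_expZ ?subr_ge0 ?qb//.
  rewrite vE -walk_expD; last 2 first.
  - by move=> g; rewrite lee_fin fine_ge0// walk_prob_ge0.
  - by move=> g; apply: sume_ge0 => i _; rewrite lee_fin.
  rewrite -{1}(walk_exp_cst mu M b%:E) -walk_expD//.
  apply: le_walk_exp => g.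
    rewrite adde_ge0//; first by rewrite lee_fin fine_ge0// walk_prob_ge0.
    by apply: sume_ge0 => i _; rewrite lee_fin.
  rewrite sumEFin -!EFinD lee_fin.
  have [[i gi]|none] := pselect (exists i, g = s i).
    rewrite (bigD1 i)//= big1 ?addr0; last first.
      by move=> j ji; rewrite /t gi (inj_eq s_inj) eq_sym (negbTE ji) mulr0.
    by rewrite /t gi eqxx mulr1 addrC subrK lerDl.
  rewrite big1 ?addr0; last first.
    move=> i _; rewrite /t; case: eqP => [gi|_]; last by rewrite mulr0.
    by case: none; exists i.
  case: ltP => [_|/qb gb]; last by rewrite addr0.
  by apply: le_trans (q1 g) _; rewrite lerDr.
have vfin : v = (fine v)%:E.
  by rewrite fineK//; have := walk_prob_fin mu (M + (T * M + n))
    (fun g => C < gromov_product o x (rho g o)); rewrite /walk_prob walk_exp_cat.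
have : (v + (\sum_(i < N) (b - qr (s i)) * a0)%:E <= b%:E + a0%:E)%E.
  apply: le_trans (le_trans key (leeD2l _ far)); rewrite leeD2l// -sumEFin.
  by apply: lee_sum => i _; rewrite EFinM lee_wpmul2l// lee_fin subr_ge0 qb.
rewrite vfin -!EFinD !lee_fin -mulr_suml sumrB sumr_const card_ord.
(* As long as [b] is at least [4 / N], a round of [M] steps saves [a0]. *)
have Nb : 4 <= b *+ N by rewrite -[b *+ N]mulr_natr -(@ler_pdivrMr R N%:R).
move: (\sum_(i < N) qr (s i)) (b *+ N) sum2 Nb => S B S2 B4 le_v.
have : fine v <= b - a0.
  have : 1 * a0 <= (B - S - 1) * a0.
    by rewrite ler_wpM2r ?(ltW a0_gt0)//; lra.
  by move: le_v; lra.
move=> va; rewrite le_max; move: va; rewrite /b maxEle -(natr1 T) mulrDl mul1r.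
by case: ifP => _ va; apply/orP; [right|left]; lra.
Qed.

(** The bound of the iteration decreases by [a0] in each round of [M] steps
    until it reaches [4 / N]. *)
Lemma shadow_small N (s : 'I_N -> G) (A L a0 D : R) M T :
  (0 < N)%N -> 0 <= A -> schottky (rho := rho) o A L s -> 2 * A + 3 * delta < L ->
  0 < a0 -> 0 <= D ->
  (forall i, a0%:E <= walk_prob mu M (pred1 (s i)))%E ->
  (forall i, mdist o (rho (s i) o) <= D) ->
  (walk_prob mu M (fun g => (D < mdist o (rho g o))%R) <= a0%:E)%E ->
  1 <= T%:R * a0 -> forall n x, (T * M <= n)%N ->
  (walk_prob mu n
      (fun g => (A + 2 * delta + T%:R * D < gromov_product o x (rho g o))%R)
    <= (4 / N%:R)%:E)%E.
Proof.
move=> N0 A0 sch AL a0_gt0 D0 atom sD far Ta n x /subnKC <-.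
apply: le_trans (shadow_iter N0 A0 sch AL a0_gt0 D0 atom sD far _ _ _) _.
by rewrite lee_fin ge_max lexx/= (le_trans _ (divr_ge0 _ (ler0n _ _)))//; lra.
Qed.

Definition orbit_len (g : G) : \bar R := (mdist o (rho g o))%:E.

(** The loss in the triangle inequality is at most [2 * C], except on an event
    which, given the first factor [g], has probability at most [eta]; there
    it is at most twice the displacement of [g], which is independent of that
    event. *)
Lemma walk_exp_almost_superadditive (C eta : R) n m : 0 <= C -> 0 <= eta ->
  (forall x, walk_prob mu m (fun h => (C < gromov_product o x (rho h o))%R)
    <= eta%:E)%E ->
  (walk_exp mu n orbit_len + walk_exp mu m orbit_len
    <= walk_exp mu (n + m) orbit_len
       + ((2 * C)%:E + (2 * eta)%:E * walk_exp mu n orbit_len))%E.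
Proof.
move=> C0 eta0 shadow.
have len0 g : (0 <= orbit_len g)%E by rewrite /orbit_len lee_fin mdist_ge0.
have inner g : (orbit_len g + walk_exp mu m orbit_len <=
    walk_exp mu m (fun h => orbit_len (g * h)%g)
    + ((2 * C)%:E + (2 * eta)%:E * orbit_len g))%E.
  pose p h := C < gromov_product o (rho g^-1%g o) (rho h o).
  apply: (@le_trans _ _ (walk_exp mu m (fun h => orbit_len (g * h)%g)
    + ((2 * C)%:E + (2 * mdist o (rho g o))%:E * walk_prob mu m p)))%E; last first.
    rewrite leeD2l// leeD2l//.
    rewrite (_ : (2 * eta)%:E * orbit_len g = (2 * mdist o (rho g o))%:E * eta%:E)%E.
      by rewrite lee_wpmul2l ?shadow// lee_fin mulr_ge0 ?mdist_ge0.
    by rewrite /orbit_len -!EFinM; congr _%:E; ring.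
  rewrite -{1}(walk_exp_cst mu m (orbit_len g)) -walk_expD//.
  rewrite -walk_expZ ?mulr_ge0//.
  rewrite -{1}(walk_exp_cst mu m (2 * C)%:E) -walk_expD//; last 2 first.
  - by move=> h; rewrite lee_fin mulr_ge0.
  - by move=> h; rewrite lee_fin mulr_ge0// mulr_ge0.
  rewrite -walk_expD//; last first.
    by move=> h; rewrite lee_fin addr_ge0// mulr_ge0// mulr_ge0.
  apply: le_walk_exp => h; first by rewrite adde_ge0.
  rewrite /orbit_len -!EFinD lee_fin (actionM iso).
  rewrite (mdist_actionr iso g o (rho h o)) /p.
  have := gromov_product_lel o (rho g^-1%g o) (rho h o).
  by case: ltP => /=; rewrite /gromov_product (orbit_distV iso); lra.
have sum0 g : (0 <= walk_exp mu m (fun h => orbit_len (g * h)%g))%E.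
  by apply: walk_exp_ge0 => h.
rewrite -{1}(walk_exp_cst mu n (walk_exp mu m orbit_len)) -walk_expD//; last first.
  by move=> g; exact: walk_exp_ge0.
rewrite walk_exp_cat -walk_expZ ?mulr_ge0//.
rewrite -{1}(walk_exp_cst mu n (2 * C)%:E) -!walk_expD//.
- apply: le_walk_exp => g; last exact: inner.
  by rewrite adde_ge0// walk_exp_ge0.
- by move=> g; rewrite adde_ge0// ?mule_ge0// lee_fin mulr_ge0.
- by move=> g; rewrite lee_fin mulr_ge0.
- by move=> g; rewrite mule_ge0// lee_fin mulr_ge0.
Qed.

End Shadow.

(** * Means and the almost sure escape rate *)

Section Moments.
Context {R : realType} {G : groupType}.
Context {mu : probability (discr G) R}.
Implicit Types (f : G -> R).
Local Open Scope ereal_scope.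

Lemma limn_einf_cst (x : \bar R) : limn_einf (fun=> x) = x.
Proof. by have [-> _] := cvg_limn_einf_sup (@cvg_cst _ x nat \oo _). Qed.

Lemma walk_exp_const_cvg (g : G) :
  (fun=> mu [set (g : discr G)]) @ \oo --> mu [set (g : discr G)].
Proof. exact: cvg_cst. Qed.

Context {c : G -> nat} (c_inj : injective c).

(** Truncations of [f] at increasing levels exhaust its mean. *)
Lemma walk_exp_le_truncated n f (K : nat -> R) (B : \bar R) :
  (forall g, (0 <= f g)%R) -> (forall j, (0 <= K j)%R) ->
  (forall x : R, exists j0, forall j, (j0 <= j)%N -> (x <= K j)%R) ->
  (\forall j \near \oo, walk_exp mu n (fun g => (Num.min (f g) (K j))%:E) <= B) ->
  walk_exp mu n (fun g => (f g)%:E) <= B.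
Proof.
move=> f0 K0 Koo HB.
rewrite -(limn_einf_cst B); apply: le_trans (limn_einf_le HB).
have min0 j g : 0 <= (Num.min (f g) (K j))%:E by rewrite lee_fin le_min f0 K0.
apply: le_trans (fatou_walk_exp c_inj n walk_exp_const_cvg min0).
apply: le_walk_exp => g; first by rewrite lee_fin.
have [j0 Hj] := Koo (f g); apply: limn_einf_ge; exists j0 => // j /= /Hj fK.
by rewrite lee_fin le_min lexx.
Qed.

Lemma walk_exp_tail n f (eps : R) : (forall g, (0 <= f g)%R) -> (0 < eps)%R ->
  walk_exp mu n (fun g => (f g)%:E) < +oo ->
  exists2 K : R, (0 <= K)%R &
    walk_exp mu n (fun g => (Num.max (f g - K) 0)%:E) <= eps%:E.
Proof.
move=> f0 eps0 fin.
set E := walk_exp mu n _ in fin.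
have E0 : 0 <= E by apply: walk_exp_ge0 => g; rewrite lee_fin.
have Efin : E \is a fin_num by rewrite ge0_fin_numE.
apply: contrapT => none.
suff : E <= E - eps%:E.
  by rewrite -{1}(fineK Efin) -[X in _ <= X - _](fineK Efin) -EFinB lee_fin; lra.
apply: (walk_exp_le_truncated (K := fun j => j%:R)) => //.
  move=> x; exists (Num.trunc x).+1 => j xj.
  by apply: le_trans (ltW (truncnS_gt x)) _; rewrite ler_nat.
apply: nearW => j; rewrite leeBrDr//.
apply: le_trans (_ : walk_exp mu n (fun g => (Num.min (f g) j%:R)%:E) +
  walk_exp mu n (fun g => (Num.max (f g - j%:R) 0)%:E) <= _).
  rewrite leeD2l// leNgt; apply/negP => small; apply: none; exists j%:R => //.
  exact: ltW.
rewrite -walk_expD; last 2 first.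
- by move=> g; rewrite lee_fin le_min f0 ler0n.
- by move=> g; rewrite lee_fin le_max lexx orbT.
apply: le_walk_exp => g.
  by rewrite -EFinD lee_fin addr_ge0// ?le_min ?f0 ?ler0n// le_max lexx orbT.
rewrite -EFinD lee_fin minEle maxEle.
by case: ifP; case: ifP; lra.
Qed.

Lemma walk_prob1 (p : pred G) : walk_prob mu 1 p = mu [set g : discr G | p (g : G)].
Proof.
rewrite -[in RHS](setIT [set g : discr G | p (g : G)]) -integral_indic//.
apply: eq_integral => g _; rewrite /= mulg1 indicE; congr ((nat_of_bool _)%:R)%:E.
by apply/idP/idP => [pg|/set_mem//]; exact/mem_set.
Qed.

(** The quantitative form of the divergence half of Borel-Cantelli: a product
    of probabilities bounded below bounds the sum of the complementary ones. *)
Lemma prod_le_invr_sum (q : nat -> R) (s : seq nat) :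
  (forall i, (0 <= q i <= 1)%R) ->
  ((\prod_(i <- s) q i) * (1 + \sum_(i <- s) (1 - q i)) <= 1)%R.
Proof.
move=> q01; elim: s => [|i s IH]; first by rewrite !big_nil addr0 mulr1.
rewrite !big_cons; set p := (\prod_(_ <- _) _)%R in IH *.
set t := (\sum_(_ <- _) _)%R in IH *.
have /andP[q0 q1] := q01 i.
have p0 : (0 <= p)%R by apply: prodr_ge0 => j _; case/andP: (q01 j).
have t0 : (0 <= t)%R.
  by apply: sumr_ge0 => j _; case/andP: (q01 j) => _; rewrite subr_ge0.
have p1 : (p <= 1)%R by apply: le_trans IH; rewrite ler_peMr// lerDl.
have h1 : (q i * (p * (1 + t)) <= q i)%R by rewrite ler_piMr.
have h2 : (q i * p * (1 - q i) <= 1 - q i)%R.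
  by rewrite ler_piMl ?subr_ge0// mulr_ile1.
by move: h1 h2; rewrite !mulrDr !mulrA; lra.
Qed.

End Moments.

Section EscapeRate.
Context {R : realType} {G : groupType} {X : metricType R}.
Context {c : G -> nat} (c_inj : injective c).
Context {rho : G -> X -> X} (iso : isometric_action rho) {o : X}.
Context {d : measure_display} {Omega : measurableType d}.
Context {P : probability Omega R}.
Context {mu : probability (discr G) R} {xi : nat -> {RV P >-> discr G}}.
Context (xi_iid : iid mu xi) {l : \bar R} (rate : ae_escape_rate rho o xi l).
Local Open Scope ereal_scope.

Let D n w : R := mdist o (rho (walk xi n w) o).
Let len (g : G) : R := mdist o (rho g o).

Lemma measurable_walk_set n (A : set G) : measurable [set w | A (walk xi n w)].
Proof.
have := measurable_walk c_inj (P := P) (xi := xi) 0 n.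
by move=> /(_ measurableT (A : set (discr G)) I); rewrite setTI.
Qed.

Lemma ae_escape_rate_ge0 : 0 <= l.
Proof.
have [w Hw] : exists w : Omega,
    (mdist o (rho (walk xi n w) o) / n%:R)%:E @[n --> \oo] --> l.
  apply: contrapT => none; move: rate => [N [mN PN sub]].
  have : P setT <= P N.
    apply: le_measure => //; rewrite ?inE// => w _.
    by apply: sub => /= Hw; apply: none; exists w.
  by rewrite probability_setT PN lee_fin; lra.
apply: (cvge_to_ge Hw); apply: nearW => n.
by rewrite lee_fin divr_ge0.
Qed.

Lemma escape_rate_event (r eps : R) : l < r%:E -> (0 < eps)%R -> exists N,
  (1 - eps)%:E <= P (\bigcap_(n in [set n | (N <= n)%N])
    [set w | (D n w <= r * n%:R)%R]).
Proof.
move=> lr eps0.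
pose B N := \bigcap_(n in [set n | (N <= n)%N]) [set w | (D n w <= r * n%:R)%R].
have mB N : measurable (B N).
  apply: bigcap_measurableType => n _.
  exact: (measurable_walk_set n [set g | (len g <= r * n%:R)%R]).
have mU : measurable (\bigcup_N B N) by exact: bigcupT_measurable.
have PU : P (\bigcup_N B N) = 1.
  have P0 : P (~` \bigcup_N B N) = 0.
    apply: measure_negligible; first exact: measurableC.
    apply: negligibleS rate => w /= nB Hw; apply: nB.
    have [N _ HN] : \forall n \near \oo, - r%:E < - (D n w / n%:R)%:E.
      apply: limn_einf_gt.
      rewrite (cvg_limn_einf_sup (_ : _ --> - l)).1 ?lteN2//.
      exact: cvgeN.
    exists N.+1 => // n /= Nn; have := HN n (ltnW Nn).
    rewrite lteN2 lte_fin ltr_pdivrMr; first by move/ltW.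
    by rewrite ltr0n (leq_trans _ Nn).
  move: P0; rewrite probability_setC// => /eqP.
  rewrite sube_eq ?fin_num_adde_defl ?fin_num_measure//.
  by rewrite add0e => /eqP <-.
have cvg : (P \o B) @ \oo --> P (\bigcup_N B N).
  apply: nondecreasing_cvg_mu => // n m nm; apply/subsetPset => w Bw k mk.
  by apply: Bw => /=; exact: leq_trans mk.
have : (1 - eps)%:E < limn_einf (P \o B).
  by rewrite (cvg_limn_einf_sup cvg).1 PU lte_fin ltrBlDr ltrDl.
move=> /limn_einf_gt[N _ HN]; exists N; apply/ltW.
exact: HN (leqnn N).
Qed.

Lemma step_len_le n w : (len (xi n w) <= D n w + D n.+1 w)%R.
Proof.
rewrite /len /D (_ : walk xi n.+1 w = (walk xi n w * (xi n w : G))%g); last first.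
  by rewrite /walk big_ord_recr.
rewrite -(mdist_action iso (walk xi n w) o) -(actionM iso).
by rewrite [X in (_ <= X + _)%R]metric_sym; exact: metric_triangle.
Qed.

(** At a linear rate the single steps are almost surely at most linear in
    their index; they are independent, so the probabilities of larger steps
    are summable, and their sum controls the mean. *)
Lemma escape_rate_finite_moment (r : R) : l < r%:E ->
  walk_exp mu 1 (fun g => (len g)%:E) < +oo.
Proof.
move=> lr; have r0 : (0 < r)%R by rewrite -lte_fin (le_lt_trans ae_escape_rate_ge0).
have [N HN] := escape_rate_event lr (divr_gt0 ltr01 (ltr0n R 2)).
(* The bound on [D n w + D n.+1 w] when both displacements are below [r] times
   their index. *)
pose K n : R := (r * (2 * n%:R + 1))%R.
have K0 n : (0 <= K n)%R by rewrite mulr_ge0 ?ltW// addr_ge0// mulr_ge0.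
pose A n : set (discr G) := [set g | (len g <= K n)%R].
pose q n := fine (mu (A n)).
have qE n : mu (A n) = (q n)%:E by rewrite fineK// fin_num_measure.
have q01 n : (0 <= q n <= 1)%R.
  by rewrite fine_ge0//= -lee_fin -qE probability_le1.
have few j : (\sum_(i < j) (1 - q (i + N)%N) <= 1)%R.
  pose s := index_iota N (j + N).
  pose J := [fset i in s]%fset.
  have Js : perm_eq (enum_fset J) s.
    by apply: uniq_perm => [||i]; rewrite ?fset_uniq ?iota_uniq// in_fset.
  have : P (cylinder (xi := xi) J A) = (\prod_(i <- s) q i)%:E.
    rewrite /cylinder xi_iid.1 -(perm_big _ Js) -prodEFin /=.
    by apply: eq_bigr => i _; rewrite -qE -(xi_iid.2 i).
  have : P (\bigcap_(n in [set n | (N <= n)%N]) [set w | (D n w <= r * n%:R)%R])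
      <= P (cylinder (xi := xi) J A).
    apply: le_measure; rewrite ?inE.
    - apply: bigcap_measurableType => n _.
      exact: (measurable_walk_set n [set g | (len g <= r * n%:R)%R]).
    - exact: measurable_cylinder.
    - move=> w Hw i /=; rewrite in_fset mem_index_iota => /andP[Ni _].
      rewrite /A /= (le_trans (step_len_le i w))//.
      have := Hw i Ni; have := Hw i.+1 (leqW Ni); rewrite /= /K -(natr1 i).
      by move: (D i.+1 w) (D i w) => y x; rewrite !mulrDr; lra.
  move=> le1 PE; have := le_trans HN le1; rewrite PE lee_fin.
  have := prod_le_invr_sum s q01.
  have -> : (\sum_(i <- s) (1 - q i) = \sum_(i < j) (1 - q (i + N)%N))%R.
    by rewrite /s -{1}(add0n N) big_addn addnK big_mkord.
  set p := (\prod_(_ <- _) _)%R; set t := (\sum_(_ < _) _)%R => pt p2.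
  have t0 : (0 <= t)%R.
    by apply: sumr_ge0 => i _; rewrite subr_ge0; case/andP: (q01 (i + N)%N).
  nra.
have trunc j g : (Num.min (len g) (K (j + N)%N) <=
    K N + 2 * r * \sum_(i < j) (K (i + N)%N < len g)%R%:R)%R.
  elim: j => [|j IH]; first by rewrite big_ord0 mulr0 addr0 add0n ge_min lexx orbT.
  rewrite big_ord_recr/= mulrDr addrA.
  have := IH; rewrite minEle; case: ltP => [lt|le].
    move=> le; rewrite ge_min; apply/orP; right.
    by rewrite mulr1 /K addSn -natr1 in le *; move: le; rewrite !mulrDr; lra.
  by rewrite mulr0 addr0 => le'; rewrite ge_min le'.
apply: (@le_lt_trans _ _ (K N + 2 * r)%:E); last exact: ltry.
apply: (walk_exp_le_truncated (K := fun j => K (j + N)%N) c_inj) => //.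
- by move=> g; exact: mdist_ge0.
- move=> x; exists (Num.trunc (x / r)).+1 => j xj; rewrite /K mulrC -ler_pdivrMr//.
  apply: le_trans (ltW (truncnS_gt (x / r))) _.
  apply: le_trans (_ : j%:R <= _)%R; first by rewrite ler_nat.
  by rewrite natrD; have := ler0n R N; have := ler0n R j; lra.
apply: nearW => j.
pose t (i : 'I_j) g : R := (2 * r * (K (i + N)%N < len g)%R%:R)%R.
have t0 i g : (0 <= t i g)%R by rewrite mulr_ge0// mulr_ge0// ltW.
apply: (@le_trans _ _ (walk_exp mu 1 (fun g => (K N)%:E + \sum_(i < j) (t i g)%:E))).
  apply: le_walk_exp => g; first by rewrite lee_fin le_min mdist_ge0 K0.
  by rewrite sumEFin -EFinD lee_fin -mulr_sumr.
rewrite walk_expD; last 2 first.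
- by move=> g; rewrite lee_fin.
- by move=> g; apply: sume_ge0 => i _; rewrite lee_fin.
rewrite walk_exp_cst walk_exp_sum; last by move=> i g; rewrite lee_fin.
rewrite EFinD leeD2l//.
apply: (@le_trans _ _ ((2 * r) * \sum_(i < j) (1 - q (i + N)%N))%:E); last first.
  by rewrite lee_fin ler_piMr ?few// mulr_ge0// ltW.
rewrite mulr_sumr -sumEFin; apply: lee_sum => i _.
rewrite (_ : (fun g => (t i g)%:E) = (fun g => (2 * r)%:E *
    ((K (i + N)%N < len g)%R%:R)%:E)) // walk_expZ; last 2 first.
- by rewrite mulr_ge0// ltW.
- by move=> g; rewrite lee_fin.
rewrite [leRHS]EFinM lee_wpmul2l//; first by rewrite lee_fin mulr_ge0// ltW.
have := walk_probC mu 1 (fun g => (K (i + N)%N < len g)%R).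
rewrite [X in _ + X = _]walk_prob1 (_ : [set _ | _] = A (i + N)%N); last first.
  by apply/seteqP; split=> g; rewrite /A /= -leNgt.
rewrite qE /walk_prob => eq1.
by rewrite EFinB -eq1 addeK.
Qed.

(** Off the event of small probability where the walk is ahead of schedule,
    its displacement is at most linear; on that event it is bounded by the sum
    of the steps, whose parts above a high level have small mean. *)
Lemma escape_rate_mean (r : R) : l < r%:E -> \forall n \near \oo,
  walk_exp mu n (fun g => (len g)%:E) <= (r * n%:R)%:E.
Proof.
move=> lr.
have [r1 lr1 r1r] : exists2 r1 : R, l < r1%:E & (r1 < r)%R.
  apply: contrapT => none; move: lr; rewrite ltNge => /negP; apply.
  apply: lee_fin_lt => x xr; rewrite leNgt; apply/negP => lx.
  by apply: none; exists x.
have eps0 : (0 < (r - r1) / 2)%R by rewrite divr_gt0// subr_gt0.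
have [K K0 tail] := walk_exp_tail c_inj (f := len) (fun g => mdist_ge0 _ _) eps0
  (escape_rate_finite_moment lr).
have e0 : (0 < (r - r1) / 2 / (K + 1))%R by rewrite divr_gt0// ltr_wpDl.
have [N HN] := escape_rate_event lr1 e0.
exists N => // n /= Nn.
pose E := [set w | (D n w <= r1 * n%:R)%R].
have mE : measurable E.
  exact: (measurable_walk_set n [set g | (len g <= r1 * n%:R)%R]).
have PE : P (~` E) <= ((r - r1) / 2 / (K + 1))%:E.
  rewrite probability_setC// leeBlDr ?fin_num_measure//.
  have : (1 - (r - r1) / 2 / (K + 1))%:E <= P E.
    apply: le_trans HN _; apply: le_measure; rewrite ?inE//.
    + apply: bigcap_measurableType => k _.
      exact: (measurable_walk_set k [set g | (len g <= r1 * k%:R)%R]).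
    + by move=> w Hw; exact: Hw Nn.
  by rewrite EFinB leeBlDr// addeC.
pose over (g : G) : R := Num.max (len g - K)%R 0%R.
have over0 g : (0 <= over g)%R by rewrite le_max lexx orbT.
have mover i : measurable_fun setT (fun w => (over (xi i w))%:E).
  exact: (measurable_step_fun i (fun g => (over g)%:E)).
have bound w : (D n w <= r1 * n%:R + n%:R * K * \1_(~` E) w
    + \sum_(i < n) over (xi i w))%R.
  have sum0 : (0 <= \sum_(i < n) over (xi i w))%R by apply: sumr_ge0.
  rewrite indicE; case: (boolP (w \in ~` E)) => [|]; last first.
    by rewrite notin_setE /= notK mulr0 addr0 => Ew; rewrite -[leLHS]addr0 lerD.
  move=> _; rewrite mulr1.
  have : (D n w <= n%:R * K + \sum_(i < n) over (xi i w))%R.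
    rewrite -[X in (X * K)%R](_ : (\sum_(i < n) 1 = n%:R)%R); last first.
      by rewrite sumr_const card_ord.
    rewrite mulr_suml -big_split /=.
    apply: le_trans (_ : \sum_(i < n) len (xi i w) <= _)%R; last first.
      by apply: ler_sum => i _; rewrite mul1r -lerBlDl le_max lexx.
    elim: (n) => [|m IH].
      by rewrite /D /walk big_ord0 (action1 iso) mdistxx big_ord0.
    rewrite big_ord_recr /=; apply: le_trans (lerD IH (lexx _)).
    rewrite /D /walk big_ord_recr; exact: orbit_distM.
  have : (0 <= r1 * n%:R)%R.
    rewrite mulr_ge0// -lee_fin; apply: le_trans (ltW lr1).
    exact: ae_escape_rate_ge0.
  lra.
have r1n : (0 <= r1 * n%:R)%R.
  rewrite mulr_ge0// -lee_fin; apply: le_trans (ltW lr1).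
  exact: ae_escape_rate_ge0.
rewrite -(integral_walk c_inj xi_iid); last by move=> g; rewrite lee_fin mdist_ge0.
apply: (@le_trans _ _ (\int[P]_w ((r1 * n%:R)%:E + (n%:R * K)%:E * (\1_(~` E) w)%:E
    + \sum_(i < n) (over (xi i w))%:E))).
  apply: ge0_le_integral => //.
  - by move=> w _; rewrite lee_fin mdist_ge0.
  - exact: (measurable_walk_fun c_inj 0 n (fun g => (len g)%:E)).
  - apply: emeasurable_funD; last by apply: emeasurable_sum.
    apply: emeasurable_funD => //; apply: measurable_funeM.
    by apply/measurable_EFinP; apply: measurable_indic; exact: measurableC.
  - by move=> w _; rewrite sumEFin -EFinM -!EFinD lee_fin; exact: bound.
have mI : measurable_fun setT (fun w => (\1_(~` E) w)%:E : \bar R).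
  by apply/measurable_EFinP; apply: measurable_indic; exact: measurableC.
rewrite ge0_integralD//; last 4 first.
- by move=> w _; rewrite -EFinM -EFinD lee_fin addr_ge0// mulr_ge0// mulr_ge0.
- by apply: emeasurable_funD => //; apply: measurable_funeM.
- by move=> w _; apply: sume_ge0 => i _; rewrite lee_fin.
- by apply: emeasurable_sum.
rewrite ge0_integralD//; last 2 first.
- by move=> w _; rewrite -EFinM lee_fin mulr_ge0// mulr_ge0.
- by apply: measurable_funeM.
rewrite integral_cst// [X in _ * X]probability_setT mule1.
rewrite ge0_integralZl//; last first.
  by rewrite lee_fin mulr_ge0.
rewrite integral_indic//; last exact: measurableC.
rewrite setIT ge0_integral_sum//; last by move=> i w _; rewrite lee_fin.
apply: (@le_trans _ _ ((r1 * n%:R)%:E + (n%:R * K)%:E * ((r - r1) / 2 / (K + 1))%:E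
   + \sum_(i < n) ((r - r1) / 2)%:E)).
  rewrite !leeD//; first by rewrite lee_wpmul2l// lee_fin mulr_ge0.
  apply: lee_sum => i _.
  by rewrite (integral_step c_inj xi_iid i (f := fun g => (over g)%:E)).
rewrite sumEFin -EFinM -!EFinD lee_fin sumr_const card_ord.
rewrite -(mulrA n%:R K) -[((r - r1) / 2 *+ n)%R]mulr_natl.
have : (K * ((r - r1) / 2 / (K + 1)) <= (r - r1) / 2)%R.
  by rewrite mulrCA ler_piMr ?(ltW eps0)// ler_pdivrMr ?ltr_wpDl// mul1r lerDl.
move=> /(ler_wpM2l (ler0n R n)).
by move: (n%:R : R)%R (n%:R * (K * _))%R => x z; lra.
Qed.

End EscapeRate.

(** * Passage to the limit *)

Section Reachable.
Context {R : realType} {G : groupType} {mu : probability (discr G) R}.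
Local Open Scope ereal_scope.

Lemma walk_prob_mul_gt0 n m (g h : G) :
  0 < walk_prob mu n (pred1 g) -> 0 < walk_prob mu m (pred1 h) ->
  0 < walk_prob mu (n + m) (pred1 (g * h)%g).
Proof.
move=> ng mh; pose v := fine (walk_prob mu m (pred1 h)).
have vE : walk_prob mu m (pred1 h) = v%:E by rewrite fineK// walk_prob_fin.
have v0 : (0 <= v)%R by rewrite fine_ge0// walk_prob_ge0.
apply: lt_le_trans (mule_gt0 mh ng) _.
rewrite vE -walk_expZ//.
rewrite [leRHS]/walk_prob walk_exp_cat; apply: le_walk_exp => g'.
  by rewrite -EFinM lee_fin mulr_ge0.
rewrite /=; case: eqP => [->|_]; last by rewrite mule0 walk_prob_ge0.
rewrite mule1 -vE; apply: le_walk_prob => h' /=.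
by rewrite (inj_eq (mulgI g)).
Qed.

Lemma walk_prob_expg_gt0 n (g : G) k : 0 < walk_prob mu n (pred1 g) ->
  0 < walk_prob mu (k * n) (pred1 (g ^+ k)%g).
Proof.
move=> ng; elim: k => [|k IH]; first by rewrite /walk_prob /= eqxx lte_fin.
by rewrite mulSn expgS; exact: walk_prob_mul_gt0.
Qed.

Lemma generated_semigroup_reachable (g : G) :
  generated_semigroup (Defs.support mu) g -> exists n, 0 < walk_prob mu n (pred1 g).
Proof.
move=> /(_ [set h : G | exists n, 0 < walk_prob mu n (pred1 h)]).
apply; split=> [h k [n nh] [m mk]|h].
  by exists (n + m)%N; exact: walk_prob_mul_gt0.
exists 1%N; rewrite walk_prob1 (_ : [set _ | _] = [set (h : discr G)])//.
by apply/seteqP; split=> h' /=; [move/eqP|move=> ->].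
Qed.

(** All the words have the same numbers of letters [a] and [b], hence are
    reached at the same time. *)
Lemma non_elementary_schottky {X : metricType R} {rho : G -> X -> X} {o : X}
    {delta : R} N (K : R) :
  isometric_action rho -> (0 <= delta)%R -> hyperbolic X delta ->
  non_elementary mu rho o -> exists A M (s : 'I_N.+1 -> G),
  [/\ (0 <= A)%R, forall i, 0 < walk_prob mu M (pred1 (s i)) &
      schottky (rho := rho) o A (2 * A + K)%R s].
Proof.
move=> iso delta0 hyp [g [h [/generated_semigroup_reachable[n ng]
  /generated_semigroup_reachable[m mh] indep]]].
have [p [q [B [_ _ tr]]]] := independent_transverse iso delta0 hyp indep.
have [A [r [J [t [A0 rt sch]]]]] := transverse_schottky iso delta0 hyp N.+1 K tr.
exists A, ((r ord0 + t ord0) * (p * n) + J * (q * m))%N,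
  (fun i => pingpong (g ^+ p)%g (h ^+ q)%g (r i) J (t i)).
split=> // i; rewrite (rt ord0 i) mulnDl addnAC.
by do 2?apply: walk_prob_mul_gt0; do 2 apply: walk_prob_expg_gt0.
Qed.

End Reachable.

Section Limit.
Context {R : realType} {G : groupType} {c : G -> nat} (c_inj : injective c).
Context {mu : option nat -> probability (discr G) R}.
Context (mu_cvg : forall g : G,
  mu (Some k) [set g] @[k --> \oo] --> mu None [set g]).
Context {X : option nat -> metricType R} {o : forall k, X k}.
Context {rho : forall k, G -> X k -> X k}.
Context (iso : forall k, isometric_action (@rho k)).
Context (rho_cvg : forall g : G,
  mdist (o (Some k)) (@rho (Some k) g (o (Some k))) @[k --> \oo]
    --> mdist (o None) (@rho None g (o None))).
Context {delta : R} (delta0 : 0 <= delta) (hyp : forall k, hyperbolic (X k) delta).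

Let len k (g : G) : R := mdist (o k) (@rho k g (o k)).

Lemma near_len_lt g (a : R) : len None g < a ->
  \forall k \near \oo, len (Some k) g < a.
Proof. by move=> ga; exact: cvgr_lt _ (@rho_cvg g) _ ga. Qed.

Lemma near_len_gt g (a : R) : a < len None g ->
  \forall k \near \oo, a < len (Some k) g.
Proof. by move=> ga; exact: cvgr_gt _ (@rho_cvg g) _ ga. Qed.

Lemma near_gromov_product_le g h (a b : R) :
  gromov_product (o None) (@rho None g (o None)) (@rho None h (o None)) <= a ->
  a < b -> \forall k \near \oo, gromov_product (o (Some k))
    (@rho (Some k) g (o (Some k))) (@rho (Some k) h (o (Some k))) <= b.
Proof.
move=> ga ab; have gE k : gromov_product (o k) (@rho k g (o k)) (@rho k h (o k)) =
    (len k g + len k h - len k (g^-1 * h)%g) / 2.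
  by rewrite /gromov_product (orbit_dist_sub (iso k)).
have e0 : 0 < (b - a) / 2 by rewrite divr_gt0// subr_gt0.
near=> k; rewrite gE.
have kg : len (Some k) g < len None g + (b - a) / 2.
  by near: k; apply: near_len_lt; rewrite ltrDl.
have kh : len (Some k) h < len None h + (b - a) / 2.
  by near: k; apply: near_len_lt; rewrite ltrDl.
have kgh : len None (g^-1 * h)%g - (b - a) / 2 < len (Some k) (g^-1 * h)%g.
  by near: k; apply: near_len_gt; rewrite ltrBlDr ltrDl.
by move: ga; rewrite gE; move: kg kh kgh; lra.
Unshelve. all: by end_near. Qed.

Lemma near_schottky A L N (s : 'I_N -> G) :
  schottky (rho := @rho None) (o None) A L s -> \forall k \near \oo,
  schottky (rho := @rho (Some k)) (o (Some k)) (A + 1) (L - 1) s.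
Proof.
move=> [sep long]; have A1 : A < A + 1 by rewrite ltrDl.
near=> k; split.
  suff H : forall i j : 'I_N, i != j ->
      gromov_product (o (Some k)) (@rho (Some k) (s i) (o (Some k)))
        (@rho (Some k) (s j) (o (Some k))) <= A + 1 /\
      gromov_product (o (Some k)) (@rho (Some k) (s i)^-1%g (o (Some k)))
        (@rho (Some k) (s j)^-1%g (o (Some k))) <= A + 1 by exact: H.
  near: k; apply: filter_forall => i; apply: filter_forall => j.
  have [->|ij] := eqVneq i j; first by apply: nearW.
  have [sij sij'] := sep i j ij.
  near=> k => _; split; near: k; exact: near_gromov_product_le A1.
near: k; apply: filter_forall => i; near=> k; apply/ltW.
by near: k; apply: near_len_gt; rewrite ltrBlDr (le_lt_trans (long i))// ltrDl.
Unshelve. all: by end_near. Qed.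

Local Open Scope ereal_scope.

(** Pointwise convergence of the step distributions only gives lower bounds on
    the probabilities of events; upper bounds are lower bounds for the
    complementary event. *)
Lemma near_walk_prob_gt n (p : nat -> pred G) (q : pred G) (a : R) :
  (forall g, q g -> \forall k \near \oo, p k g) ->
  a%:E < walk_prob (mu None) n q ->
  \forall k \near \oo, a%:E < walk_prob (mu (Some k)) n (p k).
Proof.
move=> qp aq; apply: limn_einf_gt; apply: lt_le_trans aq _.
apply: le_trans (fatou_walk_exp c_inj n mu_cvg _); last first.
  by move=> k g; rewrite lee_fin.
apply: le_walk_exp => g; first by rewrite lee_fin.
apply: limn_einf_ge; case: (boolP (q g)) => [/qp|_]; last first.
  by apply: nearW => k; rewrite lee_fin.
by apply: filterS => k ->.
Qed.

Lemma near_mean_displacement_gt n (a : R) :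
  a%:E < walk_exp (mu None) n (fun g => (len None g)%:E) ->
  \forall k \near \oo,
    a%:E < walk_exp (mu (Some k)) n (fun g => (len (Some k) g)%:E).
Proof.
move=> ag; apply: limn_einf_gt; apply: lt_le_trans ag _.
apply: le_trans (fatou_walk_exp c_inj n mu_cvg _); last first.
  by move=> k g; rewrite lee_fin mdist_ge0.
apply: le_walk_exp => g; first by rewrite lee_fin mdist_ge0.
rewrite (_ : limn_einf _ = (len None g)%:E)//.
apply: (cvg_limn_einf_sup _).1.
by apply: cvg_EFin; [exact: nearW|exact: (@rho_cvg g)].
Qed.

(** No mass escapes to infinity, because the limit distribution has total mass
    one. *)
Lemma displacement_tight n (a : R) N (s : 'I_N -> G) : (0 < a)%R -> exists D : R,
  [/\ (0 <= D)%R, (forall i, (len None (s i) < D)%R) &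
  \forall k \near \oo,
    walk_prob (mu (Some k)) n (fun g => (D < len (Some k) g)%R) <= a%:E].
Proof.
move=> a0.
have : \forall j \near \oo,
    (1 - a)%:E < walk_prob (mu None) n (fun g => (len None g < j%:R)%R).
  apply: limn_einf_gt; apply: (@lt_le_trans _ _ 1).
    by rewrite lte_fin ltrBlDr ltrDl.
  rewrite -[leLHS](walk_exp_cst (mu None) n).
  have cst_cvg := walk_exp_const_cvg (mu := mu None).
  apply: le_trans (fatou_walk_exp c_inj n cst_cvg _); last first.
    by move=> k g; rewrite lee_fin.
  apply: le_walk_exp => g //; apply: limn_einf_ge.
  exists (Num.trunc (len None g)).+1 => // j /= Hj.
  by rewrite (lt_le_trans (truncnS_gt _))// ler_nat.
move=> [j0 _ Hj].
pose j := maxn j0 (\max_(i < N) (Num.trunc (len None (s i))).+1).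
exists j%:R; split=> // [i|].
  apply: lt_le_trans (truncnS_gt _) _.
  by rewrite ler_nat leq_max (leq_bigmax i) orbT.
have near_le g : (len None g < j%:R)%R ->
    \forall k \near \oo, (len (Some k) g <= j%:R)%R.
  by move=> /near_len_lt; apply: filterS => k /ltW.
have := near_walk_prob_gt near_le (Hj j (leq_maxl _ _)).
by apply: filterS => k; apply: walk_prob_compl_le => g; rewrite /= -ltNge.
Qed.

(** The finitely many inequalities that make up the shadow estimate hold for
    the limit action with room to spare, so they hold with the same constants
    for all large [k]. *)
Lemma uniform_shadow N : non_elementary (mu None) (@rho None) (o None) ->
  exists C m, (0 <= C)%R /\ \forall k \near \oo, forall x n, (m <= n)%N ->
    walk_prob (mu (Some k)) n
      (fun g => (C < gromov_product (o (Some k)) x (@rho (Some k) g (o (Some k))))%R)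
    <= (4 / N.+1%:R)%:E.
Proof.
move=> ne; have [A [M [s [A0 reach sch]]]] :=
  non_elementary_schottky N (3 * delta + 4)%R (iso None) delta0 (@hyp None) ne.
have [a a0 atom] : exists2 a : R, (0 < a)%R &
    forall i, a%:E < walk_prob (mu None) M (pred1 (s i)).
  pose v i := fine (walk_prob (mu None) M (pred1 (s i))).
  have vE i : walk_prob (mu None) M (pred1 (s i)) = (v i)%:E.
    by rewrite fineK// walk_prob_fin.
  have v0 : (0 < \big[Num.min/1]_i v i)%R.
    by apply/bigmin_gtP; split=> // i _; rewrite -lte_fin -vE.
  exists (\big[Num.min/1]_i v i / 2)%R; first by rewrite divr_gt0.
  move=> i; rewrite vE lte_fin; apply: lt_le_trans (bigmin_le _ i _).
  by rewrite ltr_pdivrMr//; move: v0; lra.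
have [D [D0 sD far]] := displacement_tight M s a0.
have [T Ta] : exists T : nat, (1 <= T%:R * a)%R.
  exists (Num.trunc (1 / a)).+1.
  by rewrite -ler_pdivrMr// ltW// truncnS_gt.
exists (A + 1 + 2 * delta + T%:R * D)%R, (T * M)%N; split.
  by rewrite addr_ge0// ?mulr_ge0// addr_ge0 ?mulr_ge0// addr_ge0.
near=> k => x n; apply: (@shadow_small _ _ _ _ (iso _) _ delta0 (@hyp _) _ _ _ s
  (A + 1)%R (2 * A + (3 * delta + 4) - 1)%R a) => //.
- by rewrite addr_ge0.
- by near: k; exact: near_schottky.
- by lra.
- move=> i; apply/ltW; move: i; near: k; apply: filter_forall => i.
  by apply: near_walk_prob_gt (atom i) => g gi; exact: nearW.
- move=> i; apply/ltW; move: i; near: k; apply: filter_forall => i.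
  exact: near_len_lt.
- by near: k.
Unshelve. all: by end_near. Qed.

End Limit.

Section Drift.
Context {R : realType} {G : groupType} {X : metricType R}.
Context {c : G -> nat} (c_inj : injective c).
Context {rho : G -> X -> X} (iso : isometric_action rho) {o : X}.
Context {d : measure_display} {Omega : measurableType d}.
Context {P : probability Omega R}.
Context {mu : probability (discr G) R} {xi : nat -> {RV P >-> discr G}}.
Context (xi_iid : iid mu xi) {l : \bar R} (rate : ae_escape_rate rho o xi l).

Lemma mean_displacementS k :
  (walk_exp mu k.+1 (fun g => (mdist o (rho g o))%:E) <=
   walk_exp mu 1 (fun g => (mdist o (rho g o))%:E) +
   walk_exp mu k (fun g => (mdist o (rho g o))%:E))%E.
Proof.
rewrite -{1}(add1n k) walk_exp_cat.
rewrite -[in leRHS](walk_exp_cst mu 1 (walk_exp mu k _)) -walk_expD.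
- apply: le_walk_exp => g.
    by apply: walk_exp_ge0 => h; rewrite lee_fin mdist_ge0.
  rewrite -{1}(walk_exp_cst mu k (mdist o (rho g o))%:E) -walk_expD.
  + apply: le_walk_exp => h; first by rewrite lee_fin mdist_ge0.
    by rewrite -EFinD lee_fin orbit_distM.
  + by move=> h; rewrite lee_fin mdist_ge0.
  + by move=> h; rewrite lee_fin mdist_ge0.
- by move=> g; rewrite lee_fin mdist_ge0.
- by move=> g; apply: walk_exp_ge0 => h; rewrite lee_fin mdist_ge0.
Qed.

Lemma escape_rate_lt_mean (r : R) : (r%:E < l)%E -> \forall n \near \oo,
  ((r * n%:R)%:E < walk_exp mu n (fun g => (mdist o (rho g o))%:E))%E.
Proof.
move=> rl; pose f n w := (mdist o (rho (walk xi n w) o) / n%:R)%:E.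
have f0 n w : (0 <= f n w)%E by rewrite lee_fin divr_ge0.
have mf n : measurable_fun setT (f n).
  exact: (measurable_walk_fun c_inj 0 n (fun g => (mdist o (rho g o) / n%:R)%:E)).
have : (l <= limn_einf (fun n => \int[P]_w f n w))%E.
  apply: le_trans (fatou P measurableT mf (fun n w _ => f0 n w)).
  have -> : l = (\int[P]_w cst l w)%E.
    by rewrite integral_cst// [X in (_ * X)%E]probability_setT mule1.
  have mlim : measurable_fun setT (fun w => limn_einf (f^~ w)).
    apply: measurableT_comp => //; apply: measurable_fun_limn_esup => n.
    exact: measurableT_comp.
  apply: ae_ge0_le_integral => //.
  - by move=> w _; exact: (ae_escape_rate_ge0 rate).
  - by move=> w _; apply: limn_einf_ge; exact: nearW.
  - by apply: filterS rate => w Hw _; rewrite (cvg_limn_einf_sup Hw).1.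
move=> /(lt_le_trans rl)/limn_einf_gt => H; near=> n.
have n0 : 0 < n%:R :> R by rewrite ltr0n; near: n; exists 1%N.
have : (r%:E < \int[P]_w f n w)%E by near: n.
rewrite (integral_walk c_inj xi_iid n
  (f := fun g => (mdist o (rho g o) / n%:R)%:E)); last first.
  by move=> g; rewrite lee_fin divr_ge0.
have -> : walk_exp mu n (fun g => (mdist o (rho g o) / n%:R)%:E) =
    (n%:R^-1%:E * walk_exp mu n (fun g => (mdist o (rho g o))%:E))%E.
  rewrite -walk_expZ ?invr_ge0//; last by move=> g; rewrite lee_fin mdist_ge0.
  by apply: eq_walk_exp => g; rewrite mulrC EFinM.
by rewrite muleC lte_pdivlMr// EFinM.
Unshelve. all: by end_near. Qed.

(** Iterating the almost superadditivity along multiples of [n] gives a lower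
    bound for the rate that involves only the [n]-step displacement. *)
Lemma escape_rate_ge (C eta a r : R) m n :
  0 <= C -> 0 <= eta -> 2 * eta <= 1 -> 0 < a ->
  (forall x k, (m <= k)%N ->
    (walk_prob mu k (fun g => (C < gromov_product o x (rho g o))%R) <= eta%:E)%E) ->
  ((r * n%:R)%:E < walk_exp mu n (fun g => (mdist o (rho g o))%:E))%E ->
  a * n%:R + 2 * C < (1 - 2 * eta) * (r * n%:R) ->
  (a%:E <= l)%E.
Proof.
move=> C0 eta0 eta1 a0 shadow far large; rewrite leNgt; apply/negP => la.
pose E k := walk_exp mu k (fun g => (mdist o (rho g o))%:E).
have E0 k : (0 <= E k)%E by apply: walk_exp_ge0 => g; rewrite lee_fin mdist_ge0.
have [N0 _ HN] := escape_rate_mean c_inj iso xi_iid rate la.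
have E1 : (E 1%N < +oo)%E := escape_rate_finite_moment c_inj iso xi_iid rate la.
have Efin k : E k \is a fin_num.
  rewrite ge0_fin_numE//.
  apply: (@le_lt_trans _ _ (k%:R%:E * E 1%N)%E); last first.
    by rewrite lte_mul_pinfty// lee_fin.
  elim: k => [|k IH]; first by rewrite /E /= (action1 iso) mdistxx mul0e.
  apply: le_trans (mean_displacementS k) _.
  by rewrite -natr1 EFinD ge0_muleDl ?lee_fin// mul1e addeC leeD2r.
pose e k := fine (E k).
have eE k : E k = (e k)%:E by rewrite fineK.
pose b := (1 - 2 * eta) * e n - 2 * C.
have step k : (m <= k)%N -> e k + b <= e (n + k)%N.
  move=> mk; have shadow_k x := shadow x k mk.
  have := walk_exp_almost_superadditive iso n C0 eta0 shadow_k.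
  rewrite -/(E n) -/(E k) -/(E (n + k)%N) !eE -!EFinM -!EFinD lee_fin /b; lra.
have bn : a * n%:R < b.
  have : (1 - 2 * eta) * (r * n%:R) <= (1 - 2 * eta) * e n.
    rewrite ler_wpM2l ?subr_ge0// ltW// -lte_fin -eE; exact: far.
  by rewrite /b; move: large; lra.
have iter j : j%:R * b <= e (j * n + m)%N.
  elim: j => [|j IH]; first by rewrite mul0r fine_ge0.
  have := step (j * n + m)%N (leq_addl _ _).
  by rewrite addnA -mulSn -(natr1 j) mulrDl mul1r; move: IH; lra.
pose j := (N0 + (Num.trunc (a * m%:R / (b - a * n%:R))).+1)%N.
have big : a * m%:R < j%:R * (b - a * n%:R).
  rewrite -ltr_pdivrMr ?subr_gt0//; apply: lt_le_trans (truncnS_gt _) _.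
  by rewrite ler_nat leq_addl.
have [n0|n0] := posnP n.
  move: bn far large; rewrite /b n0 !mulr0 /e /E /= (action1 iso) mdistxx.
  by rewrite lte_fin ltxx.
have : (E (j * n + m)%N <= (a * (j * n + m)%:R)%:E)%E.
  apply: HN => /=; apply: leq_trans (leq_addr _ _).
  by rewrite (leq_trans (leq_addr _ _) (leq_pmulr j n0)).
rewrite eE lee_fin natrD natrM mulrDr => up.
by have := le_trans (iter j) up; move: big; rewrite mulrBr; lra.
Qed.

End Drift.

(* The index set N \cup {oo} is option nat, with None for oo. *)
Theorem theorem3 (R : realType) (G : groupType)
  (G_countable : countable [set: G])
  (mu : option nat -> probability (discr G) R)
  (mu_cvg : forall g : G, mu (Some k) [set g] @[k --> \oo] --> mu None [set g])
  (X : option nat -> metricType R)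
  (o : forall k : option nat, X k)
  (X_hyperbolic : exists2 delta : R, 0 <= delta &
     forall k : option nat, hyperbolic (X k) delta)
  (rho : forall k : option nat, G -> X k -> X k)
  (rho_isometric : forall k : option nat, isometric_action (@rho k))
  (rho_cvg : forall g : G,
     mdist (o (Some k)) (rho (Some k) g (o (Some k))) @[k --> \oo]
       --> mdist (o None) (rho None g (o None)))
  (mu_non_elementary : non_elementary (mu None) (@rho None) (o None))
  (d : option nat -> measure_display)
  (Omega : forall k : option nat, measurableType (d k))
  (P : forall k : option nat, probability (Omega k) R)
  (xi : forall k : option nat, nat -> {RV (P k) >-> discr G})
  (xi_iid : forall k : option nat, iid (mu k) (xi k))
  (l : option nat -> \bar R)
  (l_rate : forall k : option nat,
     ae_escape_rate (@rho k) (o k) (xi k) (l k)) :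
  (l None <= limn_einf (fun k : nat => l (Some k)))%E.
Proof.
have /countable_injP[c c_inj'] := G_countable.
have c_inj : injective c by move=> g h; apply: c_inj'; rewrite inE.
have [delta delta0 hyp] := X_hyperbolic.
apply: lee_fin_lt => a al; apply: limn_einf_ge.
have [a0|a0] := leP a 0.
  apply: nearW => k; apply: le_trans (ae_escape_rate_ge0 (l_rate (Some k))).
  by rewrite lee_fin.
have [r ar rl] : exists2 r : R, a < r & (r%:E < l None)%E.
  apply: contrapT => none; move: al; rewrite ltNge => /negP; apply.
  apply: lee_fin_lt => x xl; rewrite lee_fin leNgt; apply/negP => ax.
  by apply: none; exists x.
pose eta := (r - a) / (4 * r).
have r0 : 0 < r by exact: lt_trans ar.
have eta0 : 0 < eta by rewrite divr_gt0 ?subr_gt0 ?mulr_gt0.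
have etar : eta * r = (r - a) / 4 by rewrite /eta; field; rewrite gt_eqF.
have eta1 : 2 * eta <= 1.
  rewrite -(ler_pM2r r0) -mulrA etar mul1r; lra.
pose N := Num.trunc (4 / eta).
have Neta : 4 / N.+1%:R <= eta.
  by rewrite ler_pdivrMr// mulrC -ler_pdivrMr// ltW// truncnS_gt.
have [C [m [C0 shadow]]] := uniform_shadow c_inj mu_cvg rho_isometric rho_cvg
  delta0 hyp N mu_non_elementary.
have [n n1 [far large]] : exists2 n, (0 < n)%N &
    ((r * n%:R)%:E < walk_exp (mu None) n
      (fun g => (mdist (o None) (rho None g (o None)))%:E))%E
    /\ a * n%:R + 2 * C < (1 - 2 * eta) * (r * n%:R).
  have [n1 _ Hn1] := escape_rate_lt_mean c_inj (xi_iid None) (l_rate None) rl.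
  pose n := (n1 + (Num.trunc (4 * C / (r - a))).+1)%N.
  exists n; first by rewrite /n addnS.
  split; first by apply: Hn1; exact: leq_addr.
  have : 4 * C / (r - a) < n%:R.
    by apply: lt_le_trans (truncnS_gt _) _; rewrite ler_nat leq_addl.
  rewrite ltr_pdivrMr ?subr_gt0// mulrA mulrBl -mulrA etar.
  by move: (n%:R : R) => x; lra.
near=> k; apply: (escape_rate_ge c_inj (rho_isometric (Some k)) (xi_iid (Some k))
  (l_rate (Some k)) C0 (ltW eta0) eta1 a0 _ _ large).
- move=> x k'; move: x k'; near: k; apply: filterS shadow => k H x k' mk.
  by apply: le_trans (H x k' mk) _; rewrite lee_fin.
- near: k; exact: (near_mean_displacement_gt c_inj mu_cvg rho_cvg far).
Unshelve. all: by end_near. Qed.
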